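(* Let $F$ be a pseudofinite field (of any characteristic) and let $n\ge 2$ be an integer. Then a random $n$-hypergraph is interpretable in $F$; that is, there is an infinite random $n$-hypergraph $(X,R)$ which is interpretable, by first-order formulas in the language of rings with parameters from $F$, in the field $F$.
   Context: A pseudofinite field is an infinite field satisfying every first-order sentence that holds in every finite field; equivalently (Ax), a field that is perfect, has a unique extension of degree $d$ for each $d\ge 1$ (inside a fixed algebraic closure), and is pseudo algebraically closed (every absolutely irreducible variety defined over the field has a rational point over it). For a set $X$, $X^{[n]}$ denotes the set of subsets of $X$ with exactly $n$ elements. An $n$-hypergraph is a pair $(X,R)$ with $R\subseteq X^{[n]}$. An $n$-hypergraph $(X,R)$ is called random if for every finite list of distinct $a^1,\dots,a^m\in X^{[n-1]}$ and every subset $I\subseteq\{1,\dots,m\}$ there is $c\in X$ such that, for each $i\in\{1,\dots,m\}$, $a^i\cup\{c\}\in R$ if and only if $i\in I$. *)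

(* Defs.v *)
From HB Require Import structures.
From mathcomp Require Import all_boot all_order all_algebra.
From mathcomp Require Import boolp classical_sets functions cardinality.

Set Implicit Arguments.
Unset Strict Implicit.
Unset Printing Implicit Defensive.

Local Open Scope classical_set_scope.

(* Terms and formulas are those of ssralg, where [GRing.Const] plays the role
   of a parameter. [GRing.rformula] excludes [GRing.Inv] and [GRing.Unit], so
   that only the language of rings remains (numerals, integer multiples and
   natural powers abbreviate ring terms). *)

Fixpoint map_term (T1 T2 : Type) (g : T1 -> T2) (t : GRing.term T1) :
    GRing.term T2 :=
  match t with
  | GRing.Var i => GRing.Var T2 i
  | GRing.Const c => GRing.Const (g c)
  | GRing.NatConst n => GRing.NatConst T2 n
  | GRing.Add t1 t2 => GRing.Add (map_term g t1) (map_term g t2)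
  | GRing.Opp t1 => GRing.Opp (map_term g t1)
  | GRing.NatMul t1 n => GRing.NatMul (map_term g t1) n
  | GRing.Mul t1 t2 => GRing.Mul (map_term g t1) (map_term g t2)
  | GRing.Inv t1 => GRing.Inv (map_term g t1)
  | GRing.Exp t1 n => GRing.Exp (map_term g t1) n
  end.

Fixpoint map_formula (T1 T2 : Type) (g : T1 -> T2) (f : GRing.formula T1) :
    GRing.formula T2 :=
  match f with
  | GRing.Bool b => GRing.Bool b
  | GRing.Equal t1 t2 => GRing.Equal (map_term g t1) (map_term g t2)
  | GRing.Unit t => GRing.Unit (map_term g t)
  | GRing.And f1 f2 => GRing.And (map_formula g f1) (map_formula g f2)
  | GRing.Or f1 f2 => GRing.Or (map_formula g f1) (map_formula g f2)
  | GRing.Implies f1 f2 => GRing.Implies (map_formula g f1) (map_formula g f2)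
  | GRing.Not f1 => GRing.Not (map_formula g f1)
  | GRing.Exists i f1 => GRing.Exists i (map_formula g f1)
  | GRing.Forall i f1 => GRing.Forall i (map_formula g f1)
  end.

(* A [GRing.formula void] has no parameters, so it can be read in every field.
   It is evaluated as a sentence: the empty valuation gives each variable that
   is not bound by a quantifier the value of the constant 0. *)
Definition satisfies (K : fieldType) (f : GRing.formula void) : Prop :=
  GRing.holds [::] (map_formula (of_void K) f).

Definition pseudofinite (F : fieldType) : Prop :=
  infinite_set [set: F] /\
  forall f : GRing.formula void,
    GRing.rformula (map_formula (of_void F) f) ->
    (forall K : finFieldType, satisfies K f) -> satisfies F f.

Definition nsubsets (X : Type) (n : nat) : set (set X) :=
  [set A | (A #= `I_n)%card].

Record hypergraph (n : nat) : Type := Hypergraph {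
  vertex :> Type;
  edge : set (set vertex);
  edge_card : edge `<=` nsubsets n }.

Definition random_hypergraph (n : nat) (H : hypergraph n) : Prop :=
  forall (m : nat) (a : 'I_m -> set H),
    injective a -> (forall i, nsubsets n.-1 (a i)) ->
  forall I : {set 'I_m},
    exists c : H, forall i : 'I_m, edge (a i `|` [set c]) <-> i \in I.

(* An m-ary relation on k-tuples is definable with parameters when it is so as
   a subset of F^(m * k): coordinate j of the i-th tuple is variable i * k + j. *)
Definition definable (F : fieldType) (m k : nat)
    (S : set (m.-tuple (k.-tuple F))) : Prop :=
  exists f : GRing.formula F,
    GRing.rformula f /\
    forall x : m.-tuple (k.-tuple F),
      S x <-> GRing.holds (flatten [seq tval u | u <- x]) f.

(* The vertices are identified, through [pi], with the quotient of a definable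
   set D by a definable equivalence relation, namely the kernel of [pi] on D;
   the edge relation, seen as an n-ary relation, must lift to a definable one.
   The values of [pi] outside D are irrelevant. *)
Definition interpretable (F : fieldType) (n : nat) (H : hypergraph n) : Prop :=
  exists (k : nat) (D : set (k.-tuple F)) (pi : k.-tuple F -> H),
    [/\ set_surj D [set: H] pi,
        definable [set x : 1.-tuple (k.-tuple F) | D (tnth x ord0)],
        definable [set x : 2.-tuple (k.-tuple F) |
          [/\ D (tnth x ord0), D (tnth x ord_max)
            & pi (tnth x ord0) = pi (tnth x ord_max)]]
      & definable [set x : n.-tuple (k.-tuple F) |
          (forall i, D (tnth x i)) /\ edge (range (fun i => pi (tnth x i)))]].

(* Main.v *)
Require Import Defs.
From HB Require Import structures.
From mathcomp Require Import all_boot all_order all_algebra all_field.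
From mathcomp Require Import boolp.
From mathcomp Require Import zify ring.

Set Implicit Arguments.
Unset Strict Implicit.
Unset Printing Implicit Defensive.
Import Order.TTheory GRing.Theory Num.Theory.
Local Open Scope ring_scope.

(** Let [E = F(y)] with [y^2 + y + nu = 0] be the quadratic extension of [F]. The
    vertices are the pairs [(t, x)] in [E^2] with [x <> 0], and [n] vertices form an
    edge when a symmetric polynomial [f] in them is a nonzero square (in
    characteristic 2: when [1 / f] has the form [z^2 + z]). The polynomial is such
    that, for a family [a] of [n - 1] vertices, [f (a, (t, x)) = U_a(x) t + V_a(x)],
    where the rational function [V_a / U_a] determines the set [a]. So for distinct
    [a^1, ..., a^m] and generic [x] the roots [r_i] of [f (a^i, (-, x))] are distinct,
    and it remains to prescribe the quadratic (or Artin-Schreier) characters of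
    [u_i (t - r_i)] for [i <= m]. Over a finite field this is done by expanding the
    indicator of a pattern into character sums, which are bounded by the
    Stepanov-Bombieri method. That method is elementary here because the field [E],
    as a quadratic extension of a finite field, has square cardinality. The
    extension property for given [m] and [n] is first-order, so it passes
    to pseudofinite fields. *)

(** * Stepanov-Bombieri bound *)

(** Vertices are pairs so that [t] can enter linearly: the roots [r_i] then lie in the field itself,
    and a product of distinct factors [u_i (t - r_i)] has a simple root, which is all that the
    independence arguments ask for. In characteristic 2 the character is applied to [1 / f] because
    the poles of the [1 / (u_i (t - r_i))] cannot cancel in a sum, whereas a sum of the linear
    polynomials themselves may be constant. The equation [y^2 + y + nu = 0] gives, for suitable
    [nu], a quadratic extension in every characteristic, and edges are described by ring operations
    on pairs, so one formula with parameters [nu] and the points [p_i] serves all fields. *)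

Lemma poly_linear_dependence (F : fieldType) (K : finType)
    (p : K -> {poly F}) (N : nat) :
  (forall k, (size (p k) <= N)%N) -> (N < #|K|)%N ->
  exists2 A : K -> F, exists k, A k != 0 & \sum_k A k *: p k = 0.
Proof.
move=> sz_p ltNK.
pose M := \matrix_(i < #|K|, j < N) (p (enum_val i))`_j.
have kn0 : kermx M != 0.
  by rewrite kermx_eq0 /row_free neq_ltn (leq_ltn_trans (rank_leq_col M)).
pose v := nz_row (kermx M).
have vM : v *m M = 0 by apply/sub_kermxP; apply: nz_row_sub.
have [i vi] : exists i, v 0 i != 0.
  apply/existsP; apply: contraNT kn0 => /existsPn v0.
  rewrite -nz_row_eq0; apply/eqP/rowP => i; rewrite mxE.
  by apply/eqP; rewrite -[_ == _]negbK v0.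
exists (fun k => v 0 (enum_rank k)); first by exists (enum_val i); rewrite enum_valK.
apply/polyP => j; rewrite coef0 coef_sum.
have [ltjN|leNj] := ltnP j N; last first.
  by apply: big1 => k _; rewrite coefZ nth_default ?mulr0 // (leq_trans (sz_p k)).
have /matrixP /(_ 0 (Ordinal ltjN)) := vM; rewrite !mxE => vMj.
rewrite -[RHS]vMj (reindex (@enum_val K K)) /=; last first.
  by exists enum_rank => x _; rewrite ?enum_valK ?enum_rankK.
by apply: eq_bigr => k _; rewrite coefZ mxE /= enum_valK.
Qed.

(** So [x ^+ q0] is a field automorphism of [L] whose square is the identity. *)
Definition has_frobenius (L : finFieldType) (q0 : nat) :=
  (#|L| = q0 ^ 2)%N /\ [pchar L].-nat q0.

Lemma pnat_sum_exp (R : comNzRingType) (q : nat) (I : Type) (r : seq I) (E : I -> R) :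
  [pchar R].-nat q -> (\sum_(i <- r) E i) ^+ q = \sum_(i <- r) E i ^+ q.
Proof.
move=> pq; apply: (big_morph (fun x : R => x ^+ q)) => [x y|].
  exact: exprDn_pchar.
by rewrite expr0n; case: q pq.
Qed.

(** All blocks with [j > 0] are divisible by ['X^q], hence so is the block [j = 0], which [indep]
    then kills; division by ['X^q] shifts the blocks. This will show that the auxiliary polynomial
    is nonzero. *)
Lemma block_independence (L : idomainType) (q l : nat) (w0 w1 : {poly L}) :
  (forall a b : {poly L}, (size a <= l)%N -> (size b <= l)%N ->
     'X^q %| a * w0 + b * w1 -> a = 0 /\ b = 0) ->
  forall (J : nat) (a b : nat -> {poly L}),
  (forall j, (size (a j) <= l)%N) -> (forall j, (size (b j) <= l)%N) ->
  \sum_(j < J) 'X^(q * j) * (a j * w0 + b j * w1) = 0 ->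
  forall j, (j < J)%N -> a j = 0 /\ b j = 0.
Proof.
move=> indep; elim=> [//|J IHJ] a b sa sb.
have pull (s : nat -> {poly L}) :
    \sum_(j < J.+1) 'X^(q * j) * s j = s 0%N + 'X^q * \sum_(j < J) 'X^(q * j) * s j.+1.
  rewrite big_ord_recl muln0 expr0 mul1r mulr_sumr; congr (_ + _).
  by apply: eq_bigr => j _; rewrite mulrA -exprD /bump /= mulnS.
rewrite (pull (fun j => a j * w0 + b j * w1)) => sum0.
have [a0 b0] : a 0%N = 0 /\ b 0%N = 0.
  apply: indep => //; move/eqP: sum0; rewrite addr_eq0 => /eqP ->.
  by rewrite dvdpNr dvdp_mulr.
move: sum0; rewrite a0 b0 !mul0r addr0 add0r => /eqP.
rewrite mulf_eq0 expf_eq0 polyX_eq0 andbF /= => /eqP sum0.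
case=> [|j] ltj; first by [].
exact: (IHJ (fun j => a j.+1) (fun j => b j.+1)).
Qed.

(* Bombieri's variant of Stepanov's method: since [#|L|] is a square, [c ^+ q0 ^+ q0 = c], so the
   [q0]-th power of the auxiliary polynomial has at [c] the same value as one of degree about [J]. *)
Lemma stepanov_bound (L : finFieldType) (q0 : nat) (w0 w1 d0 d1 : {poly L})
    (B l J : nat) (A : {set L}) (lam : L -> L) :
  has_frobenius L q0 ->
  [/\ size w0 <= B, size w1 <= B, size d0 <= B & size d1 <= B]%N ->
  (forall a b : {poly L}, (size a <= l)%N -> (size b <= l)%N ->
     'X^q0 %| a * w0 + b * w1 -> a = 0 /\ b = 0) ->
  (J + l * q0 + B < 2 * (J * l))%N ->
  (forall c, c \in A ->
     w0.[c] ^+ q0 = lam c * d0.[c] /\ w1.[c] ^+ q0 = lam c * d1.[c]) ->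
  (#|A| <= q0 * J + l + B)%N.
Proof.
move=> [cardL pq0] [sw0 sw1 sd0 sd1] indep ltB onA.
have powK (x : L) : x ^+ q0 ^+ q0 = x.
  by rewrite -exprM mulnn -cardL expf_card.
pose d b := if b then d1 else d0; pose w b := if b then w1 else w0.
pose K := ('I_J * 'I_l * bool)%type.
pose p (k : K) := 'X^(k.1.1 + k.1.2 * q0) * d k.2.
have q0_gt0 : (0 < q0)%N by case: (q0) pq0.
have [||X [k0 Xk0] sumX] := @poly_linear_dependence L K p (J + l * q0 + B).
- move=> [[j i] b]; rewrite /p /= (leq_trans (size_polyMleq _ _)) // size_polyXn /=.
  have sd : (size (d b) <= B)%N by case: b.
  have : (i * q0 <= l * q0)%N by rewrite leq_mul2r ltnW ?orbT.
  have := ltn_ord j; move: sd; rewrite /d; set s := size _; lia.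
- by rewrite !card_prod !card_ord card_bool; lia.
(* The auxiliary polynomial [G] gets the [q0]-th powers of the [X k] as coefficients, so that the
   [q0]-th power of [G.[c]] involves the [X k] themselves. *)
pose cf b (j : nat) : {poly L} := if insub j is Some j' then
  \sum_(i < l) X (j', i, b) ^+ q0 *: 'X^i else 0.
have scf b j : (size (cf b j) <= l)%N.
  rewrite /cf; case: insubP => [j' _ _|_]; last by rewrite size_poly0.
  apply: (leq_trans (size_sum _ _ _)); apply/bigmax_leqP => i _.
  by rewrite (leq_trans (size_scale_leq _ _)) // size_polyXn.
have cfE b (j : 'I_J) : cf b j = \sum_(i < l) X (j, i, b) ^+ q0 *: 'X^i.
  by rewrite /cf valK.
pose G := \sum_(j < J) 'X^(q0 * j) * (cf false j * w0 + cf true j * w1).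
have G0 : G != 0.
  apply/eqP => /(block_independence indep (scf false) (scf true)) cf0.
  case: k0 Xk0 => [[j i] b] /negP; apply.
  have : cf b j = 0 by case: (cf0 j (ltn_ord j)); case: b.
  rewrite cfE => /polyP /(_ i); rewrite coef0 coef_sum (bigD1 i) //= big1 => [|i' neq].
    by rewrite coefZ coefXn eqxx mulr1 addr0 => /eqP; rewrite expf_eq0 => /andP[].
  by rewrite coefZ coefXn -(inj_eq val_inj) eq_sym in neq *; rewrite (negPf neq) mulr0.
have sG : (size G <= q0 * J + l + B)%N.
  apply: (leq_trans (size_sum _ _ _)); apply/bigmax_leqP => j _.
  rewrite (leq_trans (size_polyMleq _ _)) // size_polyXn /=.
  have szs b : (size (cf b j * w b)%R <= l + B)%N.
    rewrite (leq_trans (size_polyMleq _ _)) //.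
    have sw : (size (w b) <= B)%N by case: b.
    by have := scf b j; move: sw; set s := size _; set s2 := size _; lia.
  have : (size (cf false j * w0 + cf true j * w1)%R <= l + B)%N.
    by rewrite (leq_trans (size_polyD _ _)) // geq_max (szs false) (szs true).
  have : (q0 * j <= q0 * J)%N by rewrite leq_mul2l ltnW ?orbT.
  set s := size _; lia.
have rootG c : c \in A -> root G c.
  move=> cA; have [lam0 lam1] := onA c cA.
  have lamE b : (w b).[c] ^+ q0 = lam c * (d b).[c] by case: b.
  have GE : G.[c] = \sum_(k : K) c ^+ (q0 * k.1.1 + k.1.2) * (X k ^+ q0 * (w k.2).[c]).
    rewrite /G horner_sum; transitivity (\sum_(j < J) \sum_(i < l) \sum_b
        c ^+ (q0 * j + i) * (X (j, i, b) ^+ q0 * (w b).[c])); last first.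
      by rewrite pair_bigA pair_bigA; apply: eq_bigr => -[[j i] b].
    apply: eq_bigr => j _; rewrite !hornerE !cfE !horner_sum.
    rewrite !mulr_suml -big_split /= mulr_sumr.
    apply: eq_bigr => i _; rewrite big_bool /= !hornerE exprD /=; ring.
  (* In the [q0]-th power of [G.[c]] the exponent [q0 * j + i] becomes [j + i * q0] and [w] becomes
     [lam c] times [d]; what remains is [lam c] times the relation [sumX] at [c]. *)
  have := expf_eq0 G.[c] q0; rewrite q0_gt0 rootE /= => <-; apply/eqP.
  rewrite GE (pnat_sum_exp _ _ pq0).
  transitivity (lam c * (\sum_k X k *: p k).[c]); last by rewrite sumX horner0 mulr0.
  rewrite horner_sum mulr_sumr; apply: eq_bigr => -[[j i] b] _ /=.
  have cE : c ^+ (q0 * j + i) ^+ q0 = c ^+ (j + i * q0).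
    have -> : c ^+ (q0 * j + i) ^+ q0 = c ^+ q0 ^+ q0 ^+ j * c ^+ (i * q0).
      by rewrite -!exprM -exprD; congr (_ ^+ _); lia.
    by rewrite powK exprD.
  by rewrite /p /= !exprMn (powK (X _)) cE lamE !hornerE /=; ring.
have := max_poly_roots G0 (_ : all (root G) (enum A)) (enum_uniq A).
rewrite -cardE => /(_ _)/ltnW/leq_trans -> //.
by apply/allP => c; rewrite mem_enum; apply: rootG.
Qed.

(** * Independence of the auxiliary functions *)

(** Comparison of orders of vanishing at [r], run as a descent: [r] is a root of [b], hence of [a],
    and dividing both by ['X - r%:P] restores the relation. The case [e = 0] serves square roots,
    [e = 1] Artin-Schreier extensions. *)
Lemma square_relation_descent (F : fieldType) (Q1 R e : {poly F}) (r : F) :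
  Q1.[r] != 0 -> R.[r] != 0 ->
  forall a b : {poly F},
    a * (a + b * e) * (('X - r%:P) * Q1) = b ^+ 2 * R -> a = 0 /\ b = 0.
Proof.
move=> Q1r Rr a b.
have [n] := ubnP (size a + size b); elim: n a b => // n IHn a b ltn eqab.
have br : root b r.
  have /(congr1 (horner^~ r)) := eqab; rewrite !hornerE /= subrr mulr0 mul0r => /esym/eqP.
  by rewrite mulf_eq0 (negPf Rr) orbF expf_eq0.
have [b' Db] := factor_theorem _ _ br; subst b.
have Xr0 : 'X - r%:P != 0 by rewrite polyXsubC_eq0.
have eq1 : a * (a + b' * ('X - r%:P) * e) * Q1 = b' ^+ 2 * ('X - r%:P) * R.
  by apply: (mulfI Xr0); rewrite -[RHS]mulrC; transitivity ((b' * ('X - r%:P)) ^+ 2 * R);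
    [rewrite -eqab|]; ring.
have ar : root a r.
  have /(congr1 (horner^~ r)) := eq1; rewrite !hornerE /= subrr !(mul0r, mulr0) addr0 => /eqP.
  by rewrite !mulf_eq0 (negPf Q1r) orbF orbb.
have [a' Da] := factor_theorem _ _ ar; subst a.
have eq2 : a' * (a' + b' * e) * (('X - r%:P) * Q1) = b' ^+ 2 * R.
  apply: (mulfI Xr0); transitivity (b' ^+ 2 * ('X - r%:P) * R); last by ring.
  by rewrite -eq1; ring.
have [/andP[/eqP -> /eqP ->]|nz] := boolP ((a' == 0) && (b' == 0)).
  by rewrite !mul0r.
have [|-> ->] := IHn a' b' _ eq2; last by rewrite !mul0r.
have szM (c : {poly F}) : size (c * ('X - r%:P)) = ((c != 0%R) + size c)%N.
  have [->|c0] := eqVneq c 0; first by rewrite mul0r size_poly0.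
  by rewrite size_Mmonic ?monicXsubC // size_XsubC addn2.
move: ltn; rewrite !szM ltnS; move: nz (size _) (size _).
by case: (a' == 0); case: (b' == 0) => //= _ s1 s2; lia.
Qed.

Lemma eq0_of_dvdXn (F : fieldType) (q : nat) (p : {poly F}) :
  'X^q %| p -> (size p <= q)%N -> p = 0.
Proof.
move=> dvd le; apply/eqP; apply: contraTT dvd => p0.
by rewrite gtNdvdp // size_polyXn ltnS.
Qed.

(** The difference is the [q]-th power of [p - p.[0]%:P], a multiple of ['X]. Thus [q]-th powers are
    constants modulo ['X^q]. *)
Lemma dvdXn_frobenius (F : fieldType) (q : nat) (p : {poly F}) :
  [pchar F].-nat q -> 'X^q %| p ^+ q - (p.[0] ^+ q)%:P.
Proof.
move=> pq; have /factor_theorem [g] : root (p - p.[0]%:P) 0.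
  by rewrite /root !hornerE subrr.
rewrite subr0 => Dp; rewrite -{1}(subrK p.[0]%:P p) Dp exprDn_pchar.
  by rewrite rmorphXn addrK exprMn dvdp_mulIr.
by rewrite (eq_pnat _ (@pchar_poly F)).
Qed.

(** Modulo ['X^q] with [q = h.*2.+1], the square of [f ^+ h] times [f] is a constant [k].
    Multiplying the form by its conjugate [a - b * f ^+ h] and by [f] gives
    [a ^+ 2 * f - b ^+ 2 * k], which is too short to be a nonzero multiple of ['X^q]; the simple
    root of [f] then forces [a = b = 0]. *)
Lemma sqrt_independence (F : fieldType) (h l : nat) (f Q1 : {poly F}) (r : F) :
  [pchar F].-nat h.*2.+1 -> f = ('X - r%:P) * Q1 -> Q1.[r] != 0 -> f.[0] != 0 ->
  (l.*2 + size f <= h.*2.+1)%N ->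
  forall a b : {poly F}, (size a <= l)%N -> (size b <= l)%N ->
    'X^(h.*2.+1) %| a * 1 + b * f ^+ h -> a = 0 /\ b = 0.
Proof.
move=> pq Df Q1r f0 le a b sa sb; rewrite mulr1; set q := h.*2.+1 => dvd.
pose k := (f.[0] ^+ q)%:P.
have kr : k.[r] != 0 by rewrite hornerC expf_neq0.
apply: (@square_relation_descent _ Q1 k 0 r Q1r kr); rewrite -Df mulr0 addr0.
apply/eqP; rewrite -subr_eq0; apply/eqP/(@eq0_of_dvdXn _ q).
  have -> : a * a * f - b ^+ 2 * k =
      (a + b * f ^+ h) * ((a - b * f ^+ h) * f) + b ^+ 2 * (f ^+ q - k).
    have -> : f ^+ q = f ^+ h * f ^+ h * f by rewrite /q -addnn exprSr exprD.
    by ring.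
  apply: dvdp_add; first exact: dvdp_mulr.
  by apply: dvdp_mull; apply: dvdXn_frobenius.
have szM (p1 p2 : {poly F}) n1 n2 : (size p1 <= n1)%N -> (size p2 <= n2)%N ->
    (size (p1 * p2)%R <= n1 + n2)%N.
  by move=> s1 s2; rewrite (leq_trans (size_polyMleq _ _)) //; lia.
rewrite (leq_trans (size_polyD _ _)) // geq_max size_polyN; apply/andP; split.
  rewrite (leq_trans (szM _ _ (l + l) (size f) _ _))%N ?addnn //.
  by rewrite -addnn szM.
rewrite (leq_trans (szM _ _ (l + l) 1 _ _))%N ?size_polyC_leq1 ?expr2 ?szM //.
have : (0 < size f)%N by rewrite size_poly_gt0; apply: contraNneq f0 => ->; rewrite horner0.
by move: le; rewrite /q; lia.
Qed.

Definition trace2 (R : comNzRingType) (a : nat) (x : R) := \sum_(i < a) x ^+ (2 ^ i).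

(* [Q ^+ (2 ^ a)] times the partial trace of the rational function [P / Q]. *)
Definition trace2_num (R : comNzRingType) (a : nat) (P Q : R) : R :=
  \sum_(i < a.+1) P ^+ (2 ^ i) * Q ^+ (2 ^ a - 2 ^ i).

(** For the sum [T] of the [(P / Q) ^+ (2 ^ i)] with [i <= a], this is the telescoping [T ^+ 2 + T =
    (P / Q) ^+ (2 ^ a.+1) + P / Q], cleared of denominators. *)
Lemma trace2_num_sqr (R : comNzRingType) (a : nat) (P Q : R) :
  2%N \in [pchar R] ->
  Q * (trace2_num a P Q ^+ 2 + Q ^+ (2 ^ a) * trace2_num a P Q) =
  Q * P ^+ (2 ^ a.+1) + P * Q ^+ (2 ^ a.+1).
Proof.
move=> ch2; have p2 : [pchar R].-nat 2%N by rewrite pnatE.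
pose T i := P ^+ (2 ^ i) * Q ^+ (2 ^ a.+1 - 2 ^ i).
have le2 i : (i < a.+1)%N -> (2 ^ i <= 2 ^ a)%N by rewrite ltnS leq_exp2l.
have -> : trace2_num a P Q ^+ 2 = \sum_(i < a.+1) T i.+1.
  rewrite (pnat_sum_exp _ _ p2); apply: eq_bigr => i _.
  rewrite exprMn -!exprM -!expnSr /T mulnBl -!expnSr //.
have -> : Q ^+ (2 ^ a) * trace2_num a P Q = - \sum_(i < a.+1) T i.
  rewrite (oppr_pchar2 ch2) mulr_sumr; apply: eq_bigr => i _.
  rewrite mulrCA /T -exprD; congr (_ * Q ^+ _).
  by have := le2 i (ltn_ord i); rewrite expnS; lia.
rewrite -sumrB -(big_mkord xpredT (fun i => T i.+1 - T i)) telescope_sumr //.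
rewrite /T subnn expr0 mulr1 expr1 mulrBr (oppr_pchar2 ch2) mulrCA -exprS subn1.
by rewrite prednK // expn_gt0.
Qed.

(** As for square roots, but conjugation now adds [1] to the partial trace, that is [Q ^+ (2 ^ a)]
    to its numerator. The polynomial [R] does not vanish at [r] because [P / Q] has a simple pole
    there. *)
Lemma artin_schreier_independence (F : fieldType) (a l : nat) (P Q Q1 : {poly F}) (r : F) :
  2%N \in [pchar F] -> Q = ('X - r%:P) * Q1 -> Q1.[r] != 0 -> P.[r] != 0 ->
  Q.[0] != 0 -> (size P <= size Q)%N -> (l.*2 + size Q <= 2 ^ a.+1)%N ->
  forall u v : {poly F}, (size u <= l)%N -> (size v <= l)%N ->
    'X^(2 ^ a.+1) %| u * Q ^+ (2 ^ a) + v * trace2_num a P Q -> u = 0 /\ v = 0.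
Proof.
move=> ch2 DQ Q1r Pr Q0 szP le u v su sv; set q := (2 ^ a.+1)%N => dvd.
have pq : [pchar F].-nat q by rewrite pnatX pnatE ?ch2.
have chp : 2%N \in [pchar {poly F}] by rewrite pchar_poly.
pose x := P.[0] ^+ q; pose y := Q.[0] ^+ q.
have y0 : y != 0 by rewrite expf_neq0.
pose R := - (Q * x%:P + P * y%:P).
have Rr : R.[r] != 0.
  by rewrite !hornerE /= DQ !hornerE /= subrr !mul0r add0r oppr_eq0 mulf_neq0.
have Q1yr : (Q1 * y%:P).[r] != 0 by rewrite !hornerE /= mulf_neq0.
apply: (@square_relation_descent _ (Q1 * y%:P) R 1 r Q1yr Rr).
rewrite mulr1 [('X - _) * _]mulrA -DQ.
apply/eqP; rewrite -subr_eq0; apply/eqP/(@eq0_of_dvdXn _ q).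
  set w := trace2_num a P Q in dvd *.
  have twice (z : {poly F}) : z + z = 0 by rewrite -[z + z]mulr2n (mulrn_pchar chp).
  have w2 : Q * (w ^+ 2 + Q ^+ (2 ^ a) * w) = Q * P ^+ q + P * Q ^+ q.
    exact: trace2_num_sqr.
  have -> : u * (u + v) * (Q * y%:P) - v ^+ 2 * R =
      (u * Q ^+ (2 ^ a) + v * w) * (Q * (u * Q ^+ (2 ^ a) + v * (w + Q ^+ (2 ^ a))))
      + - (u * (u + v) * Q) * (Q ^+ q - y%:P)
      + - (v ^+ 2) * (P * (Q ^+ q - y%:P) + Q * (P ^+ q - x%:P)).
    have Qq : Q ^+ q = Q ^+ (2 ^ a) * Q ^+ (2 ^ a).
      by rewrite -exprD addnn -mul2n -expnS.
    have := congr1 (fun z => v ^+ 2 * z) w2; rewrite /R Qq => vw.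
    have tw := twice (u * v * Q * Q ^+ (2 ^ a) * w).
    apply/eqP; rewrite -subr_eq0; apply/eqP.
    transitivity (v ^+ 2 * (Q * P ^+ q + P * (Q ^+ (2 ^ a) * Q ^+ (2 ^ a)))
       - v ^+ 2 * (Q * (w ^+ 2 + Q ^+ (2 ^ a) * w))
       - (u * v * Q * Q ^+ (2 ^ a) * w + u * v * Q * Q ^+ (2 ^ a) * w)); first by ring.
    by rewrite -vw tw subrr subr0.
  apply: dvdp_add; first apply: dvdp_add.
  - exact: dvdp_mulr.
  - by apply: dvdp_mull; apply: dvdXn_frobenius.
  - apply: dvdp_mull; apply: dvdp_add; apply: dvdp_mull; exact: dvdXn_frobenius.
have szM (p1 p2 : {poly F}) n1 n2 : (size p1 <= n1)%N -> (size p2 <= n2)%N ->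
    (size (p1 * p2)%R <= (n1 + n2).-1)%N.
  by move=> s1 s2; rewrite (leq_trans (size_polyMleq _ _)) //; lia.
have szC (p : {poly F}) z : (size (p * z%:P)%R <= size p)%N.
  by rewrite mulrC mul_polyC size_scale_leq.
have szR : (size R <= size Q)%N.
  rewrite size_polyN (leq_trans (size_polyD _ _)) // geq_max szC /=.
  by rewrite (leq_trans (szC _ _)).
have szUV : (size (u + v)%R <= l)%N by rewrite (leq_trans (size_polyD _ _)) // geq_max su.
have tot (p1 p2 p3 : {poly F}) : (size p1 <= l)%N -> (size p2 <= l)%N ->
    (size p3 <= size Q)%N -> (size (p1 * p2 * p3)%R <= q)%N.
  move=> s1 s2 s3; apply: leq_trans le.
  rewrite (leq_trans (szM _ _ _ _ (szM _ _ _ _ s1 s2) s3)) //.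
  by rewrite -addnn; set s := size _; lia.
by rewrite (leq_trans (size_polyD _ _)) // geq_max size_polyN expr2 !tot.
Qed.

Lemma card_fibers_le2 (T1 T2 : finType) (f : T1 -> T2) (A : {set T1}) (s : T1 -> T1) :
  {in A &, forall x y, f y = f x -> (y == x) || (y == s x)} ->
  (#|A| <= #|f @: A| * 2)%N.
Proof.
move=> fib; rewrite -sum1_card (partition_big_imset f) /= -sum_nat_const.
apply: leq_sum => _ /imsetP[x xA ->].
rewrite sum1dep_card.
apply: leq_trans (_ : #|[set x; s x]| <= _)%N; last by rewrite cards2; case: eqP.
by apply/subset_leq_card/subsetP => y; rewrite !inE => /andP[yA /eqP]; apply: fib.
Qed.

(** * Quadratic and Artin-Schreier characters *)

(** With [l] near [q0 / 4], the [2 * (J * l)] unknowns need [J] slightly above [q0 / 2]; the excess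
    [2 * m + 3] pays for [B = m * q0]. The resulting bound for [#|A|] has main term [#|L| / 2]. *)
Lemma stepanov_half (L : finFieldType) (q0 m : nat) (w0 w1 d0 d1 : {poly L})
    (A : {set L}) (lam : L -> L) :
  has_frobenius L q0 -> (0 < m)%N -> (16 * m.+1 <= q0)%N ->
  [/\ size w0 <= m * q0, size w1 <= m * q0, size d0 <= m * q0 & size d1 <= m * q0]%N ->
  (forall a b : {poly L}, (size a <= q0 %/ 4)%N -> (size b <= q0 %/ 4)%N ->
     'X^q0 %| a * w0 + b * w1 -> a = 0 /\ b = 0) ->
  (forall c, c \in A ->
     w0.[c] ^+ q0 = lam c * d0.[c] /\ w1.[c] ^+ q0 = lam c * d1.[c]) ->
  (#|A| * 2 <= q0 ^ 2 + (6 * m + 7) * q0)%N.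
Proof.
move=> frobL m0 leq0 sz indep onA.
have := @stepanov_bound L q0 w0 w1 d0 d1 (m * q0) (q0 %/ 4) (q0 %/ 2 + 2 * m + 3) A lam
  frobL sz indep _ onA.
have := divn_eq q0 2; have := ltn_pmod q0 (isT : 0 < 2)%N.
have := divn_eq q0 4; have := ltn_pmod q0 (isT : 0 < 4)%N.
set s := (q0 %/ 2)%N; set l := (q0 %/ 4)%N.
move: (q0 %% 4)%N (q0 %% 2)%N => r4 r2 lt4 E4 lt2 E2 /(_ _) bd.
suff /bd : (s + 2 * m + 3 + l * q0 + m * q0 < 2 * ((s + 2 * m + 3) * l))%N by nia.
nia.
Qed.

(** Fibres have at most two elements, so the image is at least half as large as [A], and [p] has no
    more roots than that. This yields Euler's criterion for squaring and the trace criterion for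
    [z ^+ 2 + z]. *)
Lemma mem_imset_of_root (L : finFieldType) (A : {set L}) (f s : L -> L) (p : {poly L}) :
  p != 0 -> {in A &, forall x y, f y = f x -> (y == x) || (y == s x)} ->
  {in A, forall x, root p (f x)} -> ((size p).-1 * 2 <= #|A|)%N ->
  forall y, root p y -> y \in f @: A.
Proof.
move=> p0 fib rootf le y rooty; pose Z := [set z | root p z].
have leZ : (#|Z| <= (size p).-1)%N.
  rewrite -ltnS prednK ?size_poly_gt0 // cardE.
  by apply: max_poly_roots => //; [apply/allP => z; rewrite mem_enum inE|apply: enum_uniq].
suff -> : f @: A = Z by rewrite inE.
apply/eqP; rewrite eqEcard; apply/andP; split.
  by apply/subsetP => _ /imsetP[x xA ->]; rewrite inE rootf.
by have := card_fibers_le2 fib; lia.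
Qed.

(* In characteristic 2 the Artin-Schreier map takes over the role of squaring. *)
Definition residual (R : comNzRingType) (y : R) : Prop :=
  y != 0 /\ exists z : R,
    (2%:R = 0 :> R /\ y * (z ^+ 2 + z) = 1) \/ (2%:R <> 0 :> R /\ z ^+ 2 = y).

Section Residual.
Variables (L : finFieldType) (q0 : nat).
Hypothesis frobL : has_frobenius L q0.

Lemma frobenius_odd : 2%N \notin [pchar L] -> odd q0.
Proof.
move=> nch2; have [p p_pr chp] := finPcharP L.
have [cardL] := frobL; rewrite (eq_pnat _ (pcharf_eq chp)) => /p_natP[k Dk].
rewrite Dk oddX; case: (even_prime p_pr) => [p2|->]; last by rewrite orbT.
by move: nch2; rewrite -p2 chp.
Qed.

Lemma frobenius_two : 2%N \in [pchar L] -> exists a, q0 = (2 ^ a.+1)%N.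
Proof.
move=> ch2; have [cardL] := frobL; rewrite (eq_pnat _ (pcharf_eq ch2)) => /p_natP[[|a] Dk].
  by have := finNzRing_gt1 L; rewrite cardL Dk.
by exists a.
Qed.

(** Euler's criterion, with [(#|L| - 1) / 2] factored as [h * q0.+1] so that the power is [y ^+ h]
    times its own [q0]-th power. *)
Lemma residual_odd (h : nat) (y : L) : q0 = h.*2.+1 -> 2%N \notin [pchar L] -> y != 0 ->
  y ^+ (h * q0.+1) = if `[< residual y >] then 1 else -1.
Proof.
move=> Dq nch2 y0; have [cardL _] := frobL; set N := (h * q0.+1)%N.
have N2 : (N * 2 = #|L|.-1)%N by rewrite cardL /N; lia.
have two0 : (2%:R : L) <> 0 by move=> /eqP E; move: nch2; rewrite inE /= E.
have pow1 (x : L) : x != 0 -> x ^+ N ^+ 2 = 1.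
  move=> x0; rewrite -exprM N2; apply: (mulfI x0).
  by rewrite -exprS prednK ?expf_card ?mulr1 // ltnW ?finNzRing_gt1.
case: asboolP => [[_ [z [[/two0]|[_ Dz]]] //]|nres].
  by rewrite -Dz exprAC pow1 //; apply: contraNneq y0 => z0; rewrite -Dz z0 expr0n.
have /eqP := pow1 y y0; rewrite -subr_eq0 subr_sqr_1 mulf_eq0 => /orP[|]; last first.
  by rewrite addr_eq0 => /eqP.
move=> rooty; case: nres; split=> //.
have N_gt0 : (0 < N)%N.
  have gt1 : (1 < q0 ^ 2)%N by rewrite -cardL finNzRing_gt1.
  by move: N2; rewrite cardL; lia.
have szp : size ('X^N - 1 : {poly L}) = N.+1 by rewrite -[1]/(1%:P) size_XnsubC.
suff /imsetP[z _ Dz] : y \in [set x ^+ 2 | x in [set x : L | x != 0]] by exists z; right.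
apply: (mem_imset_of_root (s := fun x => - x) (p := 'X^N - 1)).
- by rewrite -size_poly_eq0 szp.
- by move=> x x' _ _ /eqP; rewrite eqf_sqr.
- move=> x; rewrite inE => x0.
  by rewrite rootE !hornerE /= -exprM mulnC exprM pow1 ?subrr.
- have -> : [set x : L | x != 0] = ~: [set 0] by apply/setP => x; rewrite !inE.
  by rewrite szp /= N2 cardsC1.
by rewrite rootE !hornerE /= rooty.
Qed.

Lemma trace2_frobenius (R : comNzRingType) (a n : nat) (x : R) : 2%N \in [pchar R] ->
  trace2 a x ^+ (2 ^ n) = \sum_(i < a) x ^+ (2 ^ (n + i)).
Proof.
move=> ch2; have pn : [pchar R].-nat (2 ^ n)%N by rewrite pnatX pnatE ?ch2.
rewrite (pnat_sum_exp _ _ pn); apply: eq_bigr => i _.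
by rewrite -exprM addnC expnD.
Qed.

(** Additive Hilbert 90: the absolute trace equals its own square, so it is [0] or [1], and its
    zeros are exactly the values of [z ^+ 2 + z]. *)
Lemma residual_two (a : nat) (y : L) : q0 = (2 ^ a.+1)%N -> 2%N \in [pchar L] -> y != 0 ->
  trace2 a.+1.*2 y^-1 = (~~ `[< residual y >])%:R.
Proof.
move=> Dq ch2 y0; have [cardL _] := frobL; rewrite doubleS; set k := a.*2.+1; set n := k.+1.
have Dn : #|L| = (2 ^ n)%N by rewrite cardL Dq -expnM muln2 doubleS.
clearbody k.
have two0 : 2%:R = 0 :> L by move: ch2; rewrite inE /= => /eqP.
have addxx (x : L) : x + x = 0 by rewrite -mulr2n -mulr_natl two0 mul0r.
have tr_sqr (x : L) : trace2 n x ^+ 2 = trace2 n x.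
  have := trace2_frobenius n 1 x ch2; rewrite expn1 => ->.
  rewrite /trace2 big_ord_recr [RHS]big_ord_recl /= add1n.
  by rewrite -/n -Dn expf_card addrC.
have tr_as (z : L) : trace2 n (z ^+ 2 + z) = 0.
  rewrite /trace2; under eq_bigr => i _.
    rewrite exprDn_pchar ?pnatX ?pnatE ?ch2 // -exprM -expnS; over.
  by rewrite big_split /= -{1}[\sum_(i < n) z ^+ (2 ^ i)]tr_sqr
    (trace2_frobenius n 1 z ch2) addxx.
case: asboolP => [[_ [z [[_ Dz]|[]//]]]|nres] /=.
  have -> : y^-1 = z ^+ 2 + z by apply: (mulfI y0); rewrite mulfV.
  by rewrite tr_as.
have /eqP := tr_sqr y^-1; rewrite -subr_eq0 expr2 -{3}[trace2 n _]mulr1 -mulrBr.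
rewrite mulf_eq0 subr_eq0 => /orP[/eqP tr0|/eqP //].
case: nres; split=> //; pose p : {poly L} := trace2 n 'X.
have pE x : p.[x] = trace2 n x.
  by rewrite horner_sum; apply: eq_bigr => i _; rewrite !hornerE.
have szp : size p = (2 ^ k).+1.
  rewrite /p /trace2 big_ord_recr /= addrC size_polyDl size_polyXn //.
  rewrite ltnS (leq_trans (size_sum _ _ _)) //; apply/bigmax_leqP => i _.
  by rewrite size_polyXn ltn_exp2l.
suff /imsetP[z _ Dz] : y^-1 \in [set x ^+ 2 + x | x in [set: L]].
  by exists z; left; rewrite -Dz mulfV.
apply: (mem_imset_of_root (s := fun x => x + 1) (p := p)).
- by rewrite -size_poly_eq0 szp.
- move=> x x' _ _ /eqP; rewrite -subr_eq0.
  have -> : x' ^+ 2 + x' - (x ^+ 2 + x) = (x' - x) * (x' - (x + 1)) + ((x' + x') * (x + 1) - (x + x) * (x + 1)).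
    by ring.
  by rewrite !addxx !mul0r subrr addr0 mulf_eq0 !subr_eq0.
- by move=> x _; rewrite rootE pE tr_as.
- by rewrite szp cardsT Dn /= mulnC -expnS.
by rewrite rootE pE tr0.
Qed.
End Residual.

Lemma trace2_sum (R : comNzRingType) (a : nat) (I : Type) (s : seq I) (P : pred I) (E : I -> R) :
  2%N \in [pchar R] -> trace2 a (\sum_(i <- s | P i) E i) = \sum_(i <- s | P i) trace2 a (E i).
Proof.
move=> ch2; rewrite exchange_big; apply: eq_bigr => j _ /=.
by rewrite -!(big_filter s P) pnat_sum_exp // pnatX pnatE ?ch2.
Qed.

(** When [q0 = 2 ^ a], the full trace is the partial trace plus its [q0]-th power, the analogue of
    the factored exponent in odd characteristic. *)
Lemma trace2_double (R : comNzRingType) (a : nat) (x : R) :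
  2%N \in [pchar R] -> trace2 a.*2 x = trace2 a x + trace2 a x ^+ (2 ^ a).
Proof.
move=> ch2; rewrite (trace2_frobenius _ _ _ ch2) /trace2 -addnn big_split_ord /=.
by congr (_ + _); apply: eq_bigr.
Qed.

(** * Joint patterns of quadratic or Artin-Schreier characters *)

Section Pattern.
Variables (L : finFieldType) (q0 m : nat) (r u : 'I_m -> L).
Hypotheses (frobL : has_frobenius L q0) (leq0 : (16 * m.+1 <= q0)%N).
Hypotheses (r_inj : injective r) (r_neq0 : forall i, r i != 0) (u_neq0 : forall i, u i != 0).

Let y (c : L) (i : 'I_m) := u i * (c - r i).
Let nonres (c : L) (S : {set 'I_m}) := (\sum_(i in S) ~~ `[< residual (y c i) >])%N.
Let off_roots (c : L) := [forall i, c != r i].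

Lemma size_polyM_leq (R : comNzRingType) (p1 p2 : {poly R}) (n1 n2 : nat) :
  (size p1 <= n1.+1)%N -> (size p2 <= n2.+1)%N -> (size (p1 * p2)%R <= (n1 + n2).+1)%N.
Proof. by move=> s1 s2; rewrite (leq_trans (size_polyMleq _ _)) //; lia. Qed.

Lemma size_polyX_leq (R : comNzRingType) (p : {poly R}) (n k : nat) :
  (size p <= n.+1)%N -> (size (p ^+ k)%R <= (n * k).+1)%N.
Proof.
move=> sp; elim: k => [|k IHk]; first by rewrite expr0 muln0 size_poly1.
by rewrite exprS mulnS size_polyM_leq.
Qed.

(** The parity of [nonres c S] is a character of one function of [c]: the product of the [y c i]
    over [S], or in characteristic 2 the sum of their inverses. Its value determines the [q0]-th
    powers of the auxiliary functions. Nonzero [r i] make the functions invertible at [0], as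
    reduction modulo powers of ['X] requires. *)
Lemma parity_class_bound (S : {set 'I_m}) (b : bool) : S != set0 ->
  (#|[set c | off_roots c & odd (nonres c S) == b]| * 2 <= q0 ^ 2 + (6 * m + 7) * q0)%N.
Proof.
case/set0Pn => i0 i0S.
have m0 : (0 < m)%N by rewrite (leq_ltn_trans _ (ltn_ord i0)).
have [cardL pq0] := frobL.
pose Q := \prod_(i in S) ('X - (r i)%:P).
pose Q1 := \prod_(i in S | i != i0) ('X - (r i)%:P).
have DQ : Q = ('X - (r i0)%:P) * Q1 by rewrite /Q (bigD1 i0).
have QE c : Q.[c] = \prod_(i in S) (c - r i).
  by rewrite horner_prod; apply: eq_bigr => i _; rewrite !hornerE.
have Q1r : Q1.[r i0] != 0.
  rewrite horner_prod; apply/prodf_neq0 => i /andP[_ ne].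
  by rewrite !hornerE subr_eq0 (inj_eq r_inj) eq_sym.
have Q0 : Q.[0] != 0 by rewrite QE; apply/prodf_neq0 => i _; rewrite sub0r oppr_eq0.
have Qc c : off_roots c -> Q.[c] != 0.
  by move/forallP => cr; rewrite QE; apply/prodf_neq0 => i _; rewrite subr_eq0.
have yc0 c i : off_roots c -> y c i != 0.
  by move/forallP => cr; rewrite mulf_neq0 // subr_eq0.
have sQ : (size Q <= m.+1)%N.
  by rewrite /Q -big_enum size_prod_XsubC ltnS -cardE (leq_trans (max_card _)) ?card_ord.
have [ch2|nch2] := boolP (2%N \in [pchar L]).
  have [a Dq] := frobenius_two frobL ch2.
  (* [P / Q] is the sum of the inverses of the [u i * ('X - r i)]; at [r i0] a single summand of [P]
     survives. *)
  pose P := \sum_(i in S) (u i)^-1 *: \prod_(j in S | j != i) ('X - (r j)%:P).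
  have Pr : P.[r i0] != 0.
    rewrite horner_sum (bigD1 i0) //= [X in _ + X]big1 => [|i /andP[iS ne]]; last first.
      rewrite hornerZ horner_prod (bigD1 i0) /= ?i0S 1?eq_sym //.
      by rewrite hornerXsubC subrr mul0r mulr0.
    by rewrite addr0 hornerZ mulf_neq0 ?invr_neq0 // -/Q1.
  have PQ c : off_roots c -> P.[c] / Q.[c] = \sum_(i in S) (y c i)^-1.
    move=> cr; rewrite horner_sum mulr_suml; apply: eq_bigr => i iS.
    have -> : Q.[c] = (c - r i) * \prod_(j in S | j != i) (c - r j).
      by rewrite QE (bigD1 i).
    rewrite hornerZ horner_prod /y; under eq_bigr => j _ do rewrite hornerXsubC.
    have nz : \prod_(j in S | j != i) (c - r j) != 0.
      by apply/prodf_neq0 => j _; move/forallP: cr => /(_ j); rewrite subr_eq0.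
    by rewrite !invfM -mulrA [X in _ * X]mulrCA mulfV ?mulr1.
  have sP : (size P <= size Q)%N.
    rewrite (leq_trans (size_sum _ _ _)) //; apply/bigmax_leqP => i iS.
    rewrite (leq_trans (size_scale_leq _ _)) //.
    apply: dvdp_leq; first by apply: contraNneq Q0 => ->; rewrite horner0.
    by rewrite /Q (bigD1 i iS) /= dvdp_mull.
  have sP' := leq_trans sP sQ.
  have a_gt0 : (0 < 2 ^ a)%N by rewrite expn_gt0.
  have bd k k' : (k + k' <= 2 ^ a)%N -> (m * k + m * k' < m * q0)%N.
    move=> le; rewrite -mulnDr Dq expnS ltn_pmul2l //.
    by apply: (leq_ltn_trans le); rewrite mul2n -addnn -{1}[(2 ^ a)%N]addn0 ltn_add2l.
  have sw0 : (size (Q ^+ (2 ^ a)) <= m * q0)%N.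
    by rewrite (leq_trans (size_polyX_leq _ sQ)) //; have := bd (2 ^ a)%N 0%N; lia.
  have sw1 : (size (trace2_num a P Q) <= m * q0)%N.
    rewrite (leq_trans (size_sum _ _ _)) //; apply/bigmax_leqP => i _.
    rewrite (leq_trans (size_polyM_leq (size_polyX_leq _ sP') (size_polyX_leq _ sQ))) //.
    by apply: bd; rewrite subnKC // leq_exp2l // -ltnS.
  (* The auxiliary functions are [1] and the partial trace [T] of [P / Q], both times
     [Q ^+ (2 ^ a)]; on the class [T ^+ q0 = T + b%:R]. *)
  apply: (@stepanov_half L q0 m (Q ^+ (2 ^ a)) (trace2_num a P Q) (Q ^+ (2 ^ a))
    (trace2_num a P Q + Q ^+ (2 ^ a) * b%:R) _
    (fun c => Q.[c] ^+ (2 ^ a) ^+ q0 / Q.[c] ^+ (2 ^ a))) => //.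
  - split=> //; rewrite (leq_trans (size_polyD _ _)) // geq_max sw1 /=.
    by rewrite mulr_natr; case: (b); rewrite ?mulr1n ?mulr0n ?size_poly0.
  - rewrite Dq; apply: (artin_schreier_independence ch2 DQ) => //.
    rewrite -Dq -muln2; have := leq_trunc_div q0 4; move: sQ; set s := size _; lia.
  - move=> c; rewrite inE => /andP[cr /eqP par]; have Qc0 := Qc c cr.
    have Qca : Q.[c] ^+ (2 ^ a) != 0 by rewrite expf_neq0.
    split; first by rewrite horner_exp divfK.
    have w1E : (trace2_num a P Q).[c] = Q.[c] ^+ (2 ^ a) * trace2 a.+1 (P.[c] / Q.[c]).
      rewrite horner_sum mulr_sumr; apply: eq_bigr => i _.
      rewrite !hornerE /= expfB_cond; last first.
        by rewrite (negPf Qc0) add0n leq_exp2l // -ltnS.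
      by rewrite exprMn exprVn; ring.
    have trE : trace2 a.+1 (P.[c] / Q.[c]) ^+ q0 = trace2 a.+1 (P.[c] / Q.[c]) + b%:R.
      have : trace2 a.+1.*2 (P.[c] / Q.[c]) = b%:R.
        rewrite (PQ c cr) (trace2_sum _ _ _ _ ch2).
        under eq_bigr => i _ do rewrite (residual_two frobL Dq ch2 (yc0 c i cr)).
        rewrite -natr_sum -/(nonres c S) -(odd_double_half (nonres c S)) par.
        by rewrite natrD -muln2 natrM (pcharf0 ch2) mulr0 addr0.
      by rewrite (trace2_double _ _ ch2) -Dq => <-; rewrite addrA -mulr2n (mulrn_pchar ch2) add0r.
    rewrite !hornerE /= w1E exprMn trE.
    have -> : b%:R.[c] = b%:R :> L by case: (b); rewrite ?hornerC.
    by rewrite -mulrDr mulrA divfK.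
have odd_q0 := frobenius_odd frobL nch2.
pose h := q0./2; have Dq : q0 = h.*2.+1 by rewrite -[LHS]odd_double_half odd_q0.
pose k := \prod_(i in S) u i; pose f := k *: Q.
have k0 : k != 0 by apply/prodf_neq0.
have fE c : f.[c] = \prod_(i in S) y c i by rewrite hornerZ QE -big_split.
have sf : (size f <= m.+1)%N by rewrite (leq_trans (size_scale_leq _ _)).
have sfh : (size (f ^+ h) <= m * q0)%N.
  by rewrite (leq_trans (size_polyX_leq _ sf)) // ltn_pmul2l // Dq -addnn; lia.
(* On the class, [f.[c] ^+ h] times its [q0]-th power is [(-1) ^+ b], so the inverse of [f.[c] ^+ h]
   serves as [lam c]. *)
apply: (@stepanov_half L q0 m 1 (f ^+ h) (f ^+ h) ((-1) ^+ b)%:P _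
    (fun c => (f.[c] ^+ h)^-1)) => //.
- by rewrite size_poly1 size_polyC signr_eq0; split=> //; rewrite muln_gt0 m0 Dq.
- rewrite Dq; apply: (@sqrt_independence _ h _ f (k *: Q1) (r i0)); rewrite -?Dq //.
  + by rewrite /f DQ scalerAr.
  + by rewrite hornerZ mulf_neq0.
  + by rewrite hornerZ mulf_neq0.
  + rewrite -muln2; have := leq_trunc_div q0 4; move: sf; set s := size _; lia.
move=> c; rewrite inE => /andP[cr /eqP par].
have fc0 : f.[c] != 0 by rewrite fE; apply/prodf_neq0 => i _; apply: yc0.
split; first by rewrite hornerC expr1n horner_exp mulVf // expf_neq0.
have fN : f.[c] ^+ (h * q0.+1) = (-1) ^+ b.
  rewrite fE -prodrXl -par signr_odd /nonres -prodrXr.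
  apply: eq_bigr => i _; rewrite (residual_odd frobL Dq nch2 (yc0 c i cr)).
  by case: asboolP.
rewrite horner_exp hornerC -fN mulnS exprD -exprM mulKf //.
by rewrite expf_neq0.
Qed.

Lemma card_off_roots : (q0 ^ 2 <= #|off_roots| + m)%N.
Proof.
have [cardL _] := frobL.
rewrite -cardL -(cardC off_roots) leq_add2l.
rewrite -[X in (_ <= X)%N]card_ord -(card_codom r_inj).
apply/subset_leq_card/subsetP => c; rewrite !inE unfold_in negb_forall => /existsP[i].
by rewrite negbK => /eqP ->; apply: codom_f.
Qed.

(** Upper bounds suffice: neither class exceeds half of [q0 ^ 2] by much, and together they miss at
    most [m] points, so neither can be much smaller than half. The missing points cost one more
    [q0]. *)
Lemma sign_sum_bound (S : {set 'I_m}) : S != set0 ->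
  (`|\sum_(c | off_roots c) (-1) ^+ nonres c S| <= ((6 * m + 8) * q0)%:Z)%R.
Proof.
move=> S0; have [cardL _] := frobL.
pose A b := [set c | off_roots c & odd (nonres c S) == b].
have bd b : (#|A b| * 2 <= q0 ^ 2 + (6 * m + 7) * q0)%N by apply: parity_class_bound.
have sumA b : \sum_(c in A b) (-1) ^+ nonres c S = (-1) ^+ b * #|A b|%:Z.
  rewrite (eq_bigr (fun _ => (-1) ^+ b)) => [|c]; last first.
    by rewrite inE => /andP[_ /eqP <-]; rewrite signr_odd.
  by rewrite sumr_const -mulr_natr natz.
have -> : \sum_(c | off_roots c) (-1) ^+ nonres c S = #|A false|%:Z - #|A true|%:Z.
  rewrite (bigID (fun c => odd (nonres c S))) /= addrC.
  rewrite (eq_bigl (mem (A false))) => [|c]; last by rewrite !inE eqbF_neg.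
  rewrite [X in _ + X](eq_bigl (mem (A true))) => [|c]; last by rewrite !inE eqb_id.
  by rewrite !sumA expr0 mul1r expr1 mulN1r.
have cardT : #|off_roots| = (#|A false| + #|A true|)%N.
  rewrite -(cardID (A false) off_roots); congr (_ + _)%N; apply: eq_card => c.
    by rewrite !inE unfold_in -/(off_roots c); case: (off_roots c).
  by rewrite !inE unfold_in -/(off_roots c); case: (off_roots c); case: (odd _).
have := card_off_roots; rewrite cardT.
have := bd true; have := bd false; nia.
Qed.

(** With [e i] the wanted sign and [x c i] the sign found, the product of the [x c i * e i + 1] is
    zero unless [c] has the pattern. Summed over [c] and expanded over subsets, the empty set
    contributes about [q0 ^ 2], and each of the fewer than [2 ^ m] others at most
    [(6 * m + 8) * q0]. *)
Lemma every_pattern_occurs (I : {set 'I_m}) : (2 ^ m * (16 * m.+1) <= q0)%N ->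
  exists c, forall i, residual (y c i) <-> i \in I.
Proof.
move=> le; apply: contrapT => /forallNP none; have [cardL _] := frobL.
pose e i : int := (-1) ^+ (i \notin I).
pose x c i : int := (-1) ^+ (~~ `[< residual (y c i) >]).
have prod0 c : \prod_i (x c i * e i + 1) = 0.
  have [i ne] : exists i, `[< residual (y c i) >] != (i \in I).
    apply: contrapT => /forallNP eqI; apply: (none c) => i.
    by have /negP := eqI i; rewrite negbK => /eqP <-; split=> /asboolP.
  apply/eqP; rewrite prodf_seq_eq0; apply/hasP; exists i; rewrite ?mem_index_enum //=.
  by move: ne; rewrite /x /e; case: asbool; case: (i \in I).
have expand c : \sum_(J : {set 'I_m}) \prod_(i in J) (x c i * e i) = 0.
  rewrite -[RHS](prod0 c) bigA_distr; apply: eq_big => [J|J _]; first by rewrite inE.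
  by rewrite [LHS]big_mkcond.
have sgn (J : {set 'I_m}) c : \prod_(i in J) (x c i * e i) = (-1) ^+ nonres c J * \prod_(i in J) e i.
  by rewrite big_split /nonres -prodrXr.
have norm_e (J : {set 'I_m}) : `|\prod_(i in J) e i| = 1.
  by rewrite normr_prod big1 // => i _; rewrite normr_sign.
have : \sum_(c | off_roots c) \sum_(J : {set 'I_m}) \prod_(i in J) (x c i * e i) = 0.
  by rewrite big1.
rewrite exchange_big (bigD1 set0) //= (eq_bigr (fun _ => 1)); last first.
  by move=> c _; rewrite big_set0.
rewrite sumr_const => /eqP; rewrite addr_eq0 => /eqP E0.
have : (`|(1 : int) *+ #|off_roots| | <= \sum_(J : {set 'I_m} | J != set0) ((6 * m + 8) * q0)%:Z)%R.
  rewrite E0 normrN (le_trans (ler_norm_sum _ _ _)) //; apply: ler_sum => J J0.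
  under eq_bigr => c _ do rewrite sgn.
  by rewrite -mulr_suml normrM norm_e mulr1 sign_sum_bound.
have cardP : (#|[pred J : {set 'I_m} | J != set0]| <= 2 ^ m)%N.
  by rewrite (leq_trans (max_card _)) // -cardsT -powersetT card_powerset cardsT card_ord.
rewrite sumr_const normrMn normr1 natz -mulr_natr natz -PoszM lez_nat => leT.
have := card_off_roots.
have := leq_mul (leqnn ((6 * m + 8) * q0)%N) cardP.
have : (m < 2 ^ m)%N by rewrite ltn_expl.
move: leT le; set t := #|off_roots|; set u2 := #|_|; set p := (2 ^ m)%N; nia.
Qed.
End Pattern.

(** * The edge polynomial *)

(* The edge polynomial is the sum over [k = (i, j)] of [prod_l x_l^(e_k) (t_l + x_l p_i + p_j)], plus
   [prod_l x_l], plus [1]. As all the [e_k] are even and large, comparing the low terms [1 + X_a x] of [V_a]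
   with [U_a] recovers [prod_l (t_l + x_l p_i + p_j)] for all [i] and [j], hence by interpolation in [p_j] the
   multiset of the [t_l + x_l p_i] for every [i]. *)
Definition block_exp (n : nat) : nat := 2 * (n * n) + 2.

Definition weight (R : comNzRingType) (n : nat) (p : 'I_n -> R) (k : 'I_n * 'I_n) (v : R * R) : R :=
  v.2 ^+ (block_exp n + 2 * enum_rank k) * (v.1 + v.2 * p k.1 + p k.2).

Definition hyper_sum (R : comNzRingType) (n : nat) (p : 'I_n -> R) (J : finType)
    (v : J -> R * R) : R :=
  \sum_k \prod_l weight p k (v l) + \prod_l (v l).2 + 1.

Definition cons_family (T : Type) (s : nat) (c : T) (v : 'I_s -> T) (i : 'I_s.+1) : T :=
  if unlift ord0 i is Some j then v j else c.

Lemma prod_cons_family (R : comNzRingType) (T : Type) (s : nat) (c : T) (v : 'I_s -> T) (g : T -> R) :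
  \prod_i g (cons_family c v i) = g c * \prod_i g (v i).
Proof.
rewrite big_ord_recl /cons_family unlift_none; congr (_ * _).
by apply: eq_bigr => i _; rewrite liftK.
Qed.

Section Slice.
Variables (F : fieldType) (s : nat) (p : 'I_s.+1 -> F).
Hypothesis p_inj : injective p.
Let n := s.+1.
Let M := block_exp n.
Let K := ('I_n * 'I_n)%type.
Implicit Types v w : 'I_s -> F * F.

Let W v (k : K) := \prod_l weight p k (v l).
Let X v := \prod_l (v l).2.
Let P v (k : K) := \prod_l ((v l).1 + (v l).2 * p k.1 + p k.2).
Let U0 v : {poly F} := \sum_k W v k *: 'X^(2 * enum_rank k).
(** [slice_lead v] and [slice_rest v] are the [U_a] and [V_a] of the overview, as polynomials in
    [x]. *)
Definition slice_lead v : {poly F} := 'X^M * U0 v.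
Let V0 v : {poly F} := \sum_k W v k *: ('X^(2 * enum_rank k) * (p k.1 *: 'X + (p k.2)%:P)).
Definition slice_rest v : {poly F} := 1 + X v *: 'X + 'X^M * V0 v.

Lemma hyper_sum_slice (v : 'I_s -> F * F) (t x : F) :
  hyper_sum p (cons_family (t, x) v) = (slice_lead v).[x] * t + (slice_rest v).[x].
Proof.
rewrite /hyper_sum prod_cons_family /slice_lead /slice_rest !hornerE /= !horner_sum.
under eq_bigr => k _ do rewrite prod_cons_family.
rewrite !mulr_sumr mulr_suml.
transitivity (\sum_k (x ^+ M * (W v k *: 'X^(2 * enum_rank k)).[x] * t +
    x ^+ M * (W v k *: ('X^(2 * enum_rank k) * (p k.1 *: 'X + (p k.2)%:P))).[x])
    + x * X v + 1).
  congr (_ + _ + _); apply: eq_bigr => k _.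
  have -> : weight p k (t, x) = x ^+ M * x ^+ (2 * enum_rank k) * (t + x * p k.1 + p k.2).
    by rewrite /weight exprD.
  by rewrite -/(W v k) !hornerE /=; ring.
by rewrite big_split /=; ring.
Qed.

Let leK (k : K) : (2 * enum_rank k + 2 < M)%N.
Proof. 
have : (enum_rank k < n * n)%N.
  have <- : #|{: K}| = (n * n)%N by rewrite card_prod !card_ord.
  exact: ltn_ord.
by rewrite /M /block_exp; set r := nat_of_ord _; lia.
Qed.

Let U0_coef v m : (U0 v)`_m = \sum_(k | m == (2 * enum_rank k)%N) W v k.
Proof.
rewrite coef_sum [RHS]big_mkcond; apply: eq_bigr => k _.
by rewrite coefZ coefXn; case: eqP => _; rewrite ?mulr1 ?mulr0.
Qed.

Let U0_even v k : (U0 v)`_(2 * enum_rank k) = W v k.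
Proof.
rewrite U0_coef (big_pred1 k) // => k' /=.
by rewrite eqn_mul2l /= (inj_eq val_inj) (inj_eq enum_rank_inj) eq_sym.
Qed.

Let U0_odd v m : odd m -> (U0 v)`_m = 0.
Proof. by move=> om; rewrite U0_coef big1 // => k /eqP E; rewrite E oddM in om. Qed.

Let size_sum_block (E : K -> {poly F}) B : (forall k, (size (E k) <= B)%N) ->
  (size (\sum_k E k)%R <= B)%N.
Proof.
by move=> sE; rewrite (leq_trans (size_sum _ _ _)) //; apply/bigmax_leqP => k _.
Qed.

Let size_U0 v : (size (U0 v) < M)%N.
Proof.
rewrite -ltnS -(@ltn_predK 0 M) // ltnS; apply: size_sum_block => k.
rewrite (leq_trans (size_scale_leq _ _)) // size_polyXn.
by have := leK k; lia.
Qed.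

(** [W v (ord0, j)] vanishes only if [p j] is one of [s] given values, and there are [s.+1] points
    [p j]. *)
Let W_neq0 v : (forall l, (v l).2 != 0) -> exists k, W v k != 0.
Proof.
move=> v0; pose g := \prod_l ('X - (- ((v l).1 + (v l).2 * p ord0))%:P).
have g0 : g != 0 by apply/monic_neq0/monic_prod => l _; apply: monicXsubC.
have [j gj] : exists j, ~~ root g (p j).
  apply/existsP; apply: contraT => /existsPn rt.
  have := max_poly_roots g0 (_ : all (root g) (codom p)) _.
  rewrite size_codom card_ord size_prod_XsubC -[index_enum _]enumT size_enum_ord ltnn.
  apply; last by apply/injectiveP.
  by apply/allP => _ /codomP[j ->]; have := rt j; rewrite negbK.
exists (ord0, j); apply/prodf_neq0 => l _; rewrite mulf_neq0 ?expf_neq0 //=.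
move: gj; rewrite /root horner_prod => /prodf_neq0/(_ l isT).
by rewrite !hornerE /= opprK addrC.
Qed.

Lemma slice_lead_neq0 v : (forall l, (v l).2 != 0) -> slice_lead v != 0.
Proof.
move=> v0; rewrite mulf_neq0 ?expf_neq0 ?polyX_eq0 //.
have [k Wk] := W_neq0 v0; apply: contraNneq Wk => U00.
by rewrite -U0_even U00 coef0.
Qed.

Lemma slice_rest_neq0 v : slice_rest v != 0.
Proof.
have : (slice_rest v).[0] != 0.
  rewrite /slice_rest hornerD hornerM hornerXn expr0n /M /block_exp addn2 mul0r addr0.
  by rewrite hornerD hornerZ hornerX mulr0 addr0 hornerC oner_neq0.
by apply: contraNneq => ->; rewrite horner0.
Qed.

Lemma size_slice_lead v : (size (slice_lead v) <= 2 * M)%N.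
Proof.
rewrite (leq_trans (size_polyMleq _ _)) // size_polyXn.
by have := size_U0 v; set z := size _; lia.
Qed.

Lemma size_slice_rest v : (size (slice_rest v) <= 2 * M)%N.
Proof.
have M2 : (2 <= M)%N by rewrite /M /block_exp leq_addl.
rewrite (leq_trans (size_polyD _ _)) // geq_max; apply/andP; split.
  rewrite (leq_trans (size_polyD _ _)) // geq_max size_poly1.
  by rewrite (leq_trans (size_scale_leq _ _)) ?size_polyX //; lia.
rewrite (leq_trans (size_polyMleq _ _)) // size_polyXn /=.
have : (size (V0 v) <= M)%N.
  apply: size_sum_block => k; rewrite (leq_trans (size_scale_leq _ _)) //.
  rewrite (leq_trans (size_polyMleq _ _)) // size_polyXn /=.
  have : (size (p k.1 *: 'X + (p k.2)%:P)%R <= 2)%N.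
    rewrite (leq_trans (size_polyD _ _)) // geq_max size_polyC.
    by rewrite (leq_trans (size_scale_leq _ _)) ?size_polyX //; case: eqP.
  by move=> sz; apply: leq_trans (leq_add (leqnn _) sz) (ltnW (leK k)).
by set z := size _; lia.
Qed.

Lemma slice_ratio_inj v w :
  (forall l, (v l).2 != 0) -> (forall l, (w l).2 != 0) ->
  slice_rest v * slice_lead w = slice_rest w * slice_lead v ->
  forall l, exists l', v l = w l'.
Proof.
move=> v0 w0 eqVU.
(* After cancelling the factor ['X^M] of the leads, only [1 + X v *: 'X] is left of [slice_rest v]
   modulo ['X^M]. Both sides have size at most [M], so the congruence is an equality. *)
have eqU : (1 + X v *: 'X) * U0 w = (1 + X w *: 'X) * U0 v.
  apply/eqP; rewrite -subr_eq0; apply/eqP/(@eq0_of_dvdXn _ M).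
    have -> : (1 + X v *: 'X) * U0 w - (1 + X w *: 'X) * U0 v
        = 'X^M * (V0 w * U0 v - V0 v * U0 w).
      apply: (@mulfI _ 'X^M); first by rewrite expf_neq0 ?polyX_eq0.
      move: eqVU => /eqP; rewrite -subr_eq0 => /eqP eqVU.
      apply/eqP; rewrite -subr_eq0; apply/eqP; rewrite -[RHS]eqVU.
      by rewrite /slice_rest /slice_lead; ring.
    exact: dvdp_mulr.
  have sz x u : (size ((1 + X x *: 'X) * U0 u)%R <= M)%N.
    rewrite (leq_trans (size_polyMleq _ _)) //.
    have : (size (1 + X x *: 'X)%R <= 2)%N.
      rewrite (leq_trans (size_polyD _ _)) // geq_max size_poly1 /=.
      by rewrite (leq_trans (size_scale_leq _ _)) ?size_polyX.
    by have := size_U0 u; set z := size _; set z' := size _; lia.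
  by rewrite (leq_trans (size_polyD _ _)) // geq_max size_polyN !sz.
have coefU x u m : ((1 + X x *: 'X) * U0 u)`_m =
    (U0 u)`_m + X x * (if m is m'.+1 then (U0 u)`_m' else 0).
  by rewrite mulrDl mul1r coefD -scalerAl coefZ coefXM; case: m.
(* [U0] has only even exponents: the even coefficients of [eqU] compare the [W], the odd ones
   compare [X v * W w k] with [X w * W v k]. *)
have eqW k : W v k = W w k.
  have /(congr1 (fun q : {poly F} => q`_(2 * enum_rank k))) := eqU.
  rewrite !coefU !U0_even mul2n; case: (nat_of_ord _) => [|r]; first by rewrite !mulr0 !addr0.
  by rewrite doubleS !U0_odd ?mulr0 ?addr0 //= odd_double.
have eqX : X v = X w.
  have [k Wk] := W_neq0 v0.
  have /(congr1 (fun q : {poly F} => q`_(2 * enum_rank k).+1)) := eqU.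
  rewrite !coefU !U0_even !U0_odd ?add0r /= ?oddM // eqW => eqXW.
  by apply: (mulIf _ eqXW); rewrite -eqW.
have X0 x : (forall l, (x l).2 != 0) -> X x != 0 by move=> x0; apply/prodf_neq0 => l _.
have WE x k : W x k = X x ^+ (M + 2 * enum_rank k) * P x k.
  by rewrite /X /P -prodrXl -big_split.
have eqPk k : P v k = P w k.
  apply: (@mulfI _ (X v ^+ (M + 2 * enum_rank k))); first by rewrite expf_neq0 ?X0.
  by rewrite -WE eqX -WE eqW.
move=> l.
(* For fixed [i], two polynomials of size [s.+1] agree at the [s.+1] points [p j], so they have the
   same roots. *)
have /fin_all_exists[h hE] : forall i, exists l',
    (v l).1 + (v l).2 * p i = (w l').1 + (w l').2 * p i.
  move=> i; pose g (x : 'I_s -> F * F) := \prod_j ('X - (- ((x j).1 + (x j).2 * p i))%:P).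
  have eqg : g v = g w.
    apply/eqP; rewrite -subr_eq0; apply: contraT => gn0.
    have := max_poly_roots gn0 (_ : all (root (g v - g w)) (codom p)) _.
    have -> : (size (codom p) < size (g v - g w)%R)%N = false.
      apply/negbTE; rewrite -leqNgt size_codom card_ord.
      rewrite (leq_trans (size_polyD _ _)) // size_polyN !size_prod_XsubC.
      by rewrite -[index_enum _]enumT size_enum_ord maxnn.
    apply; last by apply/injectiveP.
    apply/allP => _ /codomP[j ->]; have := eqPk (i, j).
    rewrite /root hornerD hornerN !horner_prod subr_eq0 /P /= => E.
    by apply/eqP; move: E; congr (_ = _); apply: eq_bigr => j' _; rewrite hornerXsubC opprK addrC.
  have : root (g w) (- ((v l).1 + (v l).2 * p i)).
    rewrite -eqg /root horner_prod prodf_seq_eq0; apply/hasP; exists l.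
      by rewrite mem_index_enum.
    by rewrite /= hornerXsubC subrr.
  rewrite /root horner_prod prodf_seq_eq0 => /hasP[l' _ /=].
  by rewrite hornerXsubC subr_eq0 eqr_opp => /eqP E; exists l'.
(* Pigeonhole: there are [s.+1] indices [i] but only [s] values of [h]. The affine function
   [t + x * p] is determined by its values at two points. *)
have /injectivePn[i [i' ne eqh]] : ~~ injectiveb h.
  apply/negP => /injectiveP/leq_card; rewrite !card_ord ltnn; exact.
exists (h i); have := hE i; have := hE i'; rewrite -eqh.
case: (v l) (w (h i)) => [t x] [t' x'] /= E' E.
have : (x - x') * (p i - p i') = 0.
  transitivity ((t + x * p i) - (t' + x' * p i) - ((t + x * p i') - (t' + x' * p i'))).
    by ring.
  by rewrite E E' !subrr.
move/eqP; rewrite mulf_eq0 !subr_eq0 (inj_eq p_inj) (negPf ne) orbF => /eqP Dx.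
by move: E; rewrite Dx => /addIr ->.
Qed.
End Slice.

Lemma common_nonroot (L : finFieldType) (K : finType) (g : K -> {poly L}) (D : nat) :
  (forall k, g k != 0) -> (forall k, (size (g k) <= D)%N) -> (#|K| * D < #|L|)%N ->
  exists x, forall k, (g k).[x] != 0.
Proof.
move=> g0 sg lt; pose G := \prod_k g k.
have G0 : G != 0 by apply/prodf_neq0.
have [x rx] : exists x, ~~ root G x.
  apply/existsP; apply: contraT => /existsPn rt.
  have := max_poly_roots G0 (_ : all (root G) (enum L)) (enum_uniq L).
  rewrite -cardE => /(_ _) lt'.
  have /lt' : all (root G) (enum L) by apply/allP => x _; have := rt x; rewrite negbK.
  rewrite /G size_prod // => lt2.
  have : (\sum_k size (g k) <= #|K| * D)%N by rewrite -sum_nat_const leq_sum.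
  have K0 : (0 < #|K|)%N \/ #|K| = 0%N by lia.
  have : (1 < #|L|)%N := finNzRing_gt1 L.
  by move: lt lt2; set a := bigop _ _ _; set b := #|_|; lia.
by exists x => k; move: rx; rewrite /root horner_prod => /prodf_neq0/(_ k isT).
Qed.

(** The first summand is what [every_pattern_occurs] needs; the second is the number of polynomials
    whose roots [x] must avoid, times a bound for their sizes. *)
Definition size_threshold (m s : nat) : nat :=
  2 ^ m * (16 * m.+1) + (1 + m * s + (m + m) + m * m) * (4 * block_exp s.+1).

Theorem extension_property_finite (L : finFieldType) (q0 m s : nat) (p : 'I_s.+1 -> L)
    (v : 'I_m -> 'I_s -> L * L) (I : {set 'I_m}) :
  has_frobenius L q0 -> (size_threshold m s <= q0)%N -> injective p ->
  (forall i l, (v i l).2 != 0) ->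
  (forall i j, i != j ->
     ~ ((forall l, exists l', v i l = v j l') /\ (forall l, exists l', v j l = v i l'))) ->
  exists c : L * L, [/\ c.2 != 0, forall i l, c <> v i l &
    forall i, residual (hyper_sum p (cons_family c (v i))) <-> i \in I].
Proof.
move=> frobL leq0 p_inj v0 vdiff; have [cardL _] := frobL.
pose U i := slice_lead p (v i); pose V i := slice_rest p (v i).
pose M := block_exp s.+1.
pose K := (unit + 'I_m * 'I_s + ('I_m + 'I_m) + 'I_m * 'I_m)%type.
(* A nonroot [x] of all of these makes, in this order, [c.2] nonzero, [c] new, every slice of degree
   1 in [t], every [r i] nonzero, and the [r i] distinct; [1] fills the diagonal. *)
pose g (k : K) : {poly L} := match k with
  | inl (inl (inl _)) => 'X
  | inl (inl (inr (i, l))) => 'X - (v i l).2%:P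
  | inl (inr (inl i)) => U i
  | inl (inr (inr i)) => V i
  | inr (i, j) => if i == j then 1 else V i * U j - V j * U i
  end.
have M2 : (2 <= M)%N by rewrite /M /block_exp leq_addl.
have U0 i : U i != 0 by apply: slice_lead_neq0.
have [||| x gx] := @common_nonroot L K g (4 * M).
- case=> [[[[]|[i l]]|[i|i]]|[i j]] /=; rewrite ?polyX_eq0 ?polyXsubC_eq0 //.
    exact: slice_rest_neq0.
  case: (eqVneq i j) => [_|ne]; first by rewrite oner_eq0.
  rewrite subr_eq0; apply/eqP => eqVU; apply: (vdiff i j ne); split.
    exact: (slice_ratio_inj p_inj (v0 i) (v0 j) eqVU).
  exact: (slice_ratio_inj p_inj (v0 j) (v0 i) (esym eqVU)).
- have sU i : (size (U i) <= 2 * M)%N by apply: size_slice_lead.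
  have sV i : (size (V i) <= 2 * M)%N by apply: size_slice_rest.
  have sM i j : (size (V i * U j)%R <= 4 * M)%N.
    rewrite (leq_trans (size_polyMleq _ _)) //; have := sU j; have := sV i.
    by set z := size _; set z' := size _; lia.
  case=> [[[[]|[i l]]|[i|i]]|[i j]] /=; rewrite ?size_polyX ?size_XsubC.
  + by lia.
  + by lia.
  + by apply: leq_trans (sU i) _; lia.
  + by apply: leq_trans (sV i) _; lia.
  + case: eqP => _; first by rewrite size_poly1; lia.
    by rewrite (leq_trans (size_polyD _ _)) // geq_max size_polyN !sM.
- rewrite !card_sum !card_prod !card_ord card_unit cardL.
  move: leq0; rewrite /size_threshold -/M.
  have : (0 < 2 ^ m * (16 * m.+1))%N by rewrite muln_gt0 expn_gt0.
  by set b := (_ * (16 * _))%N; set c := (_ * (4 * M))%N; nia.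
have Ux i : (U i).[x] != 0 by have := gx (inl (inr (inl i))).
have Vx i : (V i).[x] != 0 by have := gx (inl (inr (inr i))).
pose r i := - ((V i).[x] / (U i).[x]).
have r_inj : injective r.
  move=> i j /oppr_inj eqr; apply/eqP; apply: contraT => ne.
  have := gx (inr (i, j)); rewrite /= (negPf ne) hornerD hornerN !(hornerM (V _) (U _)) subr_eq0.
  by rewrite -eqr_div // eqr eqxx.
have r0 i : r i != 0 by rewrite oppr_eq0 mulf_neq0 ?invr_neq0.
have [|| t tP] := @every_pattern_occurs L q0 m r (fun i => (U i).[x]) frobL _ r_inj r0 Ux I.
- move: leq0; rewrite /size_threshold; have : (0 < 2 ^ m)%N by rewrite expn_gt0.
  by set b := (2 ^ m)%N; nia.
- by move: leq0; rewrite /size_threshold; lia.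
exists (t, x); split=> [|i l|i].
- by have := gx (inl (inl (inl tt))); rewrite /= hornerX.
- move=> Dv; have := gx (inl (inl (inr (i, l)))).
  by rewrite /= hornerXsubC -Dv subrr eqxx.
rewrite -tP hyper_sum_slice -/(U i) -/(V i) /r opprK mulrDr [_ * (_ / _)]mulrCA mulfV //.
by rewrite mulr1.
Qed.

(** * Quadratic extensions *)

(* The pair [(a, b)] stands for [a + b y], where [y ^ 2 + y + nu = 0]. *)
Definition quad (R : Type) (nu : R) : Type := (R * R)%type.

Section Quad.
Variables (R : comNzRingType) (nu : R).
HB.instance Definition _ := GRing.Zmodule.on (quad nu).
Definition quad_one : quad nu := (1, 0).
Definition quad_mul (u v : quad nu) : quad nu :=
  (u.1 * v.1 - nu * (u.2 * v.2), u.1 * v.2 + u.2 * v.1 - u.2 * v.2).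

Lemma quad_addE (u v : quad nu) : u + v = (u.1 + v.1, u.2 + v.2). Proof. by []. Qed.

Lemma quad_mulC : commutative quad_mul.
Proof. by move=> [a b] [c d]; congr (_, _) => /=; ring. Qed.
Lemma quad_mulA : associative quad_mul.
Proof. by move=> [a b] [c d] [e f]; congr (_, _) => /=; ring. Qed.
Lemma quad_mul1 : left_id quad_one quad_mul.
Proof. by move=> [a b]; congr (_, _) => /=; ring. Qed.
Lemma quad_mulD : left_distributive quad_mul +%R.
Proof. by move=> [a b] [c d] [e f]; rewrite !quad_addE; congr (_, _) => /=; ring. Qed.
Lemma quad_one_neq0 : quad_one != 0.
Proof. by apply/eqP => -[/eqP]; rewrite oner_eq0. Qed.
HB.instance Definition _ :=
  GRing.Zmodule_isComNzRing.Build (quad nu) quad_mulA quad_mulC quad_mul1 quad_mulD quad_one_neq0.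

Lemma quad_mulE (u v : quad nu) : u * v =
  (u.1 * v.1 - nu * (u.2 * v.2), u.1 * v.2 + u.2 * v.1 - u.2 * v.2).
Proof. by []. Qed.

Definition quad_inj (x : R) : quad nu := (x, 0).
End Quad.

Definition rootless (R : comNzRingType) (nu : R) := forall z : R, z ^+ 2 + z + nu != 0.

(** Having [irr] in the type lets the field structure, which depends on it, be attached to this copy
    of [quad nu]. *)
Definition quad_field (K : fieldType) (nu : K) (irr : rootless nu) : Type := quad nu.

Section QuadField.
Variables (K : fieldType) (nu : K) (irr : rootless nu).
HB.instance Definition _ := GRing.ComNzRing.on (quad_field irr).

(** The product of [a + b y] with its conjugate [(a - b) - b y], since the other root is
    [- 1 - y]. *)
Definition quad_norm (u : quad_field irr) : K := u.1 ^+ 2 - u.1 * u.2 + nu * u.2 ^+ 2.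
Definition quad_inv (u : quad_field irr) : quad_field irr :=
  ((u.1 - u.2) / quad_norm u, - u.2 / quad_norm u).

Lemma quad_norm_neq0 (u : quad_field irr) : u != 0 -> quad_norm u != 0.
Proof.
case: u => a b; apply: contraNneq; rewrite /quad_norm /= => N0.
have [b0|b0] := eqVneq b 0.
  by move: N0; rewrite b0 mulr0 expr0n mulr0 subr0 addr0 => /eqP; rewrite expf_eq0 => /eqP ->.
have := irr (- a / b); have -> : (- a / b) ^+ 2 + - a / b + nu = 0; last by rewrite eqxx.
have b2 : b ^+ 2 != 0 by rewrite expf_neq0.
apply: (mulfI b2); rewrite mulr0 -[RHS]N0; field => //.
Qed.

Lemma quad_mulVf (u : quad_field irr) : u != 0 -> quad_inv u * u = 1.
Proof.
move=> /quad_norm_neq0; case: u => a b; rewrite quad_mulE /quad_inv /quad_norm /= => N0.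
by congr (_, _); field.
Qed.

Lemma quad_inv0 : quad_inv 0 = 0.
Proof. by rewrite /quad_inv /= subrr oppr0 !mul0r. Qed.

HB.instance Definition _ := GRing.ComNzRing_isField.Build (quad_field irr) quad_mulVf quad_inv0.
End QuadField.

HB.instance Definition _ (K : finFieldType) (nu : K) (irr : rootless nu) :=
  Finite.on (quad_field irr).

Lemma card_quad_field (K : finFieldType) (nu : K) (irr : rootless nu) :
  #|{: quad_field irr}| = (#|K| ^ 2)%N.
Proof. by rewrite (card_prod K K) mulnn. Qed.

Lemma quad_field_frobenius (K : finFieldType) (nu : K) (irr : rootless nu) :
  has_frobenius (quad_field irr : finFieldType) #|K|.
Proof.
split; first exact: card_quad_field.
have [p p_pr chp] := finPcharP K.
have chq : p \in [pchar (quad_field irr)].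
  rewrite inE /= p_pr; apply/eqP.
  have natE k : k%:R = (k%:R, 0) :> quad_field irr.
    by elim: k => // k IHk; rewrite mulrSr IHk; congr (_, _) => /=; rewrite ?mulrSr ?addr0.
  by rewrite natE (pcharf0 chp).
by rewrite (eq_pnat _ (pcharf_eq chq)) (card_pprimeChar chp) pnatX pnat_id.
Qed.

(** [z ^+ 2 + z] agrees at [0] and [- 1], so on a finite field it is not surjective. *)
Lemma exists_rootless (K : finFieldType) : exists nu : K, rootless nu.
Proof.
apply: contrapT => /forallNP all_root; pose f (z : K) := - (z ^+ 2 + z).
have fsurj nu : exists z, f z = nu.
  apply: contrapT => /forallNP nz; apply: (all_root nu) => z; apply/negP => /eqP E.
  by apply: (nz z); rewrite /f; apply/eqP; rewrite eq_sym -addr_eq0 addrC E.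
have f_inj : injectiveb f.
  rewrite /injectiveb /dinjectiveb; apply/card_uniqP; rewrite size_codom.
  apply: eq_card => nu; have [z <-] := fsurj nu.
  by rewrite codom_f.
have f01 : f 0 = f (- 1) by rewrite /f; ring.
have /eqP := injectiveP _ f_inj _ _ f01.
by rewrite eq_sym oppr_eq0 oner_eq0.
Qed.

(** * Uniform first-order definability *)

Definition env (T : finType) (K : Type) (h : T -> K) : seq K := [seq h t | t <- enum T].

(* The variables are indexed by [enum T]; allowing an arbitrary continuation [e] of the valuation makes
   these notions stable under enlarging [T]. *)
Definition term_definable (T : finType) (g : forall K : fieldType, (T -> K) -> K) : Prop :=
  exists2 t : GRing.term void,
    forall K : fieldType, GRing.rterm (map_term (of_void K) t) &
    forall (K : fieldType) (h : T -> K) (e : seq K),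
      GRing.eval (env h ++ e) (map_term (of_void K) t) = g K h.

Definition form_definable (T : finType) (P : forall K : fieldType, (T -> K) -> Prop) : Prop :=
  exists2 f : GRing.formula void,
    forall K : fieldType, GRing.rformula (map_formula (of_void K) f) &
    forall (K : fieldType) (h : T -> K) (e : seq K),
      GRing.holds (env h ++ e) (map_formula (of_void K) f) <-> P K h.

Definition sum_fun (T U : Type) (K : Type) (h : T -> K) (g : U -> K) (x : T + U) : K :=
  match x with inl t => h t | inr u => g u end.

Lemma size_env (T : finType) (K : Type) (h : T -> K) : size (env h) = #|T|.
Proof. by rewrite size_map -cardE. Qed.

Lemma nth_env (T : finType) (K : Type) (x0 : K) (h : T -> K) (t : T) :
  nth x0 (env h) (enum_rank t) = h t.
Proof. by rewrite (nth_map t) ?nth_enum_rank // -cardE ltn_ord. Qed.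

Lemma env_sum (T U : finType) (K : Type) (h : T + U -> K) :
  env h = env (h \o inl) ++ env (h \o inr).
Proof.
rewrite /env (map_comp h inl) (map_comp h inr) -map_cat; congr (map _ _).
by rewrite !enumT [in LHS]unlock.
Qed.

Lemma env_surj (T : finType) (K : fieldType) (s : seq K) :
  size s = #|T| -> env (fun t : T => nth 0 s (enum_rank t)) = s.
Proof.
move=> ss; apply: (@eq_from_nth _ 0); first by rewrite size_env.
move=> i; rewrite size_env => lti.
by rewrite -[i]/(val (Ordinal lti)) -[Ordinal lti]enum_valK nth_env.
Qed.

Section TermClosure.
Variable T : finType.
Implicit Types g : forall K : fieldType, (T -> K) -> K.

Lemma term_definable_var (t : T) : term_definable (fun K h => h t).
Proof.
exists (GRing.Var void (enum_rank t)) => // K h e /=.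
by rewrite nth_cat size_env ltn_ord nth_env.
Qed.

Lemma term_definable_nat (k : nat) : term_definable (fun K (h : T -> K) => k%:R).
Proof. by exists (GRing.NatConst void k). Qed.

Lemma term_definable_add g1 g2 : term_definable g1 -> term_definable g2 ->
  term_definable (fun K h => g1 K h + g2 K h).
Proof.
move=> [t1 r1 e1] [t2 r2 e2]; exists (GRing.Add t1 t2) => [K|K h e] /=; first by rewrite r1 r2.
by rewrite e1 e2.
Qed.

Lemma term_definable_mul g1 g2 : term_definable g1 -> term_definable g2 ->
  term_definable (fun K h => g1 K h * g2 K h).
Proof.
move=> [t1 r1 e1] [t2 r2 e2]; exists (GRing.Mul t1 t2) => [K|K h e] /=; first by rewrite r1 r2.
by rewrite e1 e2.
Qed.

Lemma term_definable_opp g : term_definable g -> term_definable (fun K h => - g K h).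
Proof.
move=> [t r e]; exists (GRing.Opp t) => [K|K h e'] /=; first by rewrite r.
by rewrite e.
Qed.
End TermClosure.

Lemma term_definable_inl (T U : finType) (g : forall K : fieldType, (T -> K) -> K) :
  term_definable g -> @term_definable (T + U)%type (fun K h => g K (h \o inl)).
Proof.
move=> [t r e]; exists t => // K h e'.
by rewrite env_sum -catA e.
Qed.

Section FormClosure.
Variable T : finType.
Implicit Types P Q : forall K : fieldType, (T -> K) -> Prop.

Lemma form_definable_ext P Q : (forall K h, P K h <-> Q K h) ->
  form_definable P -> form_definable Q.
Proof. by move=> PQ [f r e]; exists f => // K h e'; rewrite e. Qed.

(** Conditions on indices, such as [i \in I], are the same in all fields and enter a formula as
    truth values. *)
Lemma form_definable_const (A : Prop) : form_definable (fun K (h : T -> K) => A).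
Proof. by exists ((GRing.Bool `[< A >] : GRing.formula void)) => //= K h e; split=> /asboolP. Qed.

Lemma form_definable_eq g1 g2 : @term_definable T g1 -> @term_definable T g2 ->
  form_definable (fun K h => g1 K h = g2 K h).
Proof.
move=> [t1 r1 e1] [t2 r2 e2]; exists (GRing.Equal t1 t2) => [K|K h e] /=; first by rewrite r1 r2.
by rewrite e1 e2.
Qed.

Lemma form_definable_and P Q : form_definable P -> form_definable Q ->
  form_definable (fun K h => P K h /\ Q K h).
Proof.
move=> [t1 r1 e1] [t2 r2 e2]; exists (GRing.And t1 t2) => [K|K h e] /=; first by rewrite r1 r2.
by rewrite e1 e2.
Qed.

Lemma form_definable_or P Q : form_definable P -> form_definable Q ->
  form_definable (fun K h => P K h \/ Q K h).
Proof.
move=> [t1 r1 e1] [t2 r2 e2]; exists (GRing.Or t1 t2) => [K|K h e] /=; first by rewrite r1 r2.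
by rewrite e1 e2.
Qed.

Lemma form_definable_imp P Q : form_definable P -> form_definable Q ->
  form_definable (fun K h => P K h -> Q K h).
Proof.
move=> [t1 r1 e1] [t2 r2 e2]; exists (GRing.Implies t1 t2) => [K|K h e] /=; first by rewrite r1 r2.
by rewrite e1 e2.
Qed.

Lemma form_definable_not P : form_definable P -> form_definable (fun K h => ~ P K h).
Proof.
move=> [t1 r1 e1]; exists (GRing.Not t1) => [K|K h e] /=; first by rewrite r1.
by rewrite e1.
Qed.

Lemma form_definable_iff P Q : form_definable P -> form_definable Q ->
  form_definable (fun K h => P K h <-> Q K h).
Proof. by move=> dP dQ; apply: form_definable_and; apply: form_definable_imp. Qed.

Lemma form_definable_finall (I : finType) (P : I -> forall K : fieldType, (T -> K) -> Prop) :
  (forall i, form_definable (P i)) -> form_definable (fun K h => forall i, P i K h).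
Proof.
move=> dP; suff [f r e] : form_definable (fun K h => forall i, i \in enum I -> P i K h).
  by exists f => // K h e'; rewrite e; split=> H i; [apply: H; rewrite mem_enum|move=> _; apply: H].
elim: (enum I) => [|i s IHs].
  by apply: form_definable_ext (form_definable_const True).
apply: form_definable_ext (form_definable_and (dP i) IHs) => K h; split=> [[Pi Ps] j|Ps].
  by rewrite inE => /predU1P[->|/Ps].
by split=> [|j js]; apply: Ps; rewrite inE ?eqxx ?js ?orbT.
Qed.

Lemma form_definable_finex (I : finType) (P : I -> forall K : fieldType, (T -> K) -> Prop) :
  (forall i, form_definable (P i)) -> form_definable (fun K h => exists i, P i K h).
Proof.
move=> dP; have dN i := form_definable_not (dP i).
apply: form_definable_ext (form_definable_not (form_definable_finall dN)) => K h.
by split=> [/existsNP[i /contrapT Pi]|[i Pi] /(_ i)] //; exists i.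
Qed.
End FormClosure.

Definition forall_block (K : Type) (b k : nat) (f : GRing.formula K) : GRing.formula K :=
  foldr (fun i f' => GRing.Forall i f') f (iota b k).

Lemma set_nth_cat_size (K : Type) (x0 x : K) (e e' : seq K) :
  set_nth x0 (e ++ e') (size e) x = rcons e x ++ behead e'.
Proof. by elim: e => [|y e IHe] /=; [case: e'|rewrite IHe]. Qed.

(** The quantified variables overwrite the first [k] entries of [e'], which is harmless when the
    continuation is arbitrary. *)
Lemma holds_forall_block (K : fieldType) (k : nat) (f : GRing.formula K) (e e' : seq K) :
  GRing.holds (e ++ e') (forall_block (size e) k f) <->
  forall s, size s = k -> GRing.holds (e ++ s ++ drop k e') f.
Proof.
elim: k e e' => [|k IHk] e e'.
  by rewrite /forall_block /= drop0; split=> [H [|//]|H] //; apply: (H [::]).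
rewrite /forall_block /=; split=> [H [//|x s] [ss]|H x].
  have := H x; rewrite set_nth_cat_size -(size_rcons e x) => /IHk/(_ s ss).
  by rewrite cat_rcons -drop1 drop_drop addn1.
rewrite set_nth_cat_size -(size_rcons e x); apply/IHk => s ss.
by rewrite cat_rcons -drop1 drop_drop addn1; apply: (H (x :: s)); rewrite /= ss.
Qed.

Lemma form_definable_forall (T U : finType) (P : forall K : fieldType, (T + U -> K) -> Prop) :
  @form_definable (T + U)%type P ->
  form_definable (fun K (h : T -> K) => forall g : U -> K, P K (sum_fun h g)).
Proof.
move=> [f r e]; exists (forall_block #|T| #|U| f) => [K|K h e'].
  by rewrite /forall_block; elim: (iota _ _).
have -> : map_formula (of_void K) (forall_block #|T| #|U| f) =
    forall_block (size (env h)) #|U| (map_formula (of_void K) f).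
  by rewrite size_env /forall_block; elim: (iota _ _) => //= i s ->.
rewrite holds_forall_block; split=> [H g|H s ss].
  have := H (env g) (size_env g); rewrite catA.
  have -> : env h ++ env g = env (sum_fun h g) by rewrite env_sum.
  by move/e.
rewrite -(env_surj ss) catA; set g := fun _ => _.
have -> : env h ++ env g = env (sum_fun h g) by rewrite env_sum.
exact/e/H.
Qed.

Lemma form_definable_exists (T U : finType) (P : forall K : fieldType, (T + U -> K) -> Prop) :
  @form_definable (T + U)%type P ->
  form_definable (fun K (h : T -> K) => exists g : U -> K, P K (sum_fun h g)).
Proof.
move=> dP; have := form_definable_not (form_definable_forall (form_definable_not dP)).
apply: form_definable_ext => K h.
by split=> [/existsNP[g /contrapT Pg]|[g Pg] /(_ g)] //; exists g.
Qed.

Lemma rformula_fsubst (K : fieldType) (f : GRing.formula K) (i : nat) (x : K) :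
  GRing.rformula f -> GRing.rformula (GRing.fsubst f (i, GRing.Const x)).
Proof.
have rt (t : GRing.term K) : GRing.rterm t -> GRing.rterm (GRing.tsubst t (i, GRing.Const x)).
  by elim: t => //= [j|t1 IH1 t2 IH2 /andP[/IH1 -> /IH2 ->]|t1 IH1 t2 IH2 /andP[/IH1 -> /IH2 ->]] //;
    case: eqP.
elim: f => //=.
- by move=> t1 t2 /andP[/rt -> /rt ->].
- by move=> f1 IH1 f2 IH2 /andP[/IH1 -> /IH2 ->].
- by move=> f1 IH1 f2 IH2 /andP[/IH1 -> /IH2 ->].
- by move=> f1 IH1 f2 IH2 /andP[/IH1 -> /IH2 ->].
- by move=> j f1 IH1; case: eqP.
- by move=> j f1 IH1; case: eqP.
Qed.

(** The variables of [U] come after those of [T], so they can be replaced by constants one at a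
    time, leaving a formula in the variables of [T]. *)
Lemma definable_with_parameters (T U : finType) (P : forall K : fieldType, (T + U -> K) -> Prop)
    (F : fieldType) (g : U -> F) :
  @form_definable (T + U)%type P ->
  exists2 f : GRing.formula F, GRing.rformula f &
    forall h : T -> F, GRing.holds (env h) f <-> P F (sum_fun h g).
Proof.
move=> [f0 r e].
have [f rf fE] : exists2 f : GRing.formula F, GRing.rformula f &
    forall e : seq F, size e = #|T| ->
      (GRing.holds e f <-> GRing.holds (e ++ env g) (map_formula (of_void F) f0)).
  move: (env g) #|T| (map_formula _ _) (r F) => s b f1; elim: s b => [|x s IHs] b rf1.
    by exists f1 => // e'; rewrite cats0.
  have [f rf fE] := IHs b.+1 rf1; exists (GRing.fsubst f (b, GRing.Const x)).
    exact: rformula_fsubst.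
  move=> e' se'; rewrite GRing.holds_fsubst -se' -{1}[e']cats0 set_nth_cat_size cats0.
  by rewrite fE ?size_rcons ?se' // cat_rcons.
exists f => // h; rewrite fE ?size_env //.
have -> : env h ++ env g = env (sum_fun h g) by rewrite env_sum.
by rewrite -[env (sum_fun h g)]cats0 e.
Qed.

Lemma pseudofinite_transfer (F : fieldType) (P : forall K : fieldType, (void -> K) -> Prop) :
  pseudofinite F -> @form_definable void P ->
  (forall (K : finFieldType) h, P K h) -> forall h, P F h.
Proof.
move=> [_ pF] [f r e] Pfin h.
have env0 (K : fieldType) (h' : void -> K) : env h' = [::].
  by apply: size0nil; rewrite size_env card_void.
have := e F h [::]; rewrite env0 => -[toP _]; apply: toP; apply: pF => // K.
have := e K (of_void K) [::]; rewrite env0 => -[_ ofP].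
exact/ofP/Pfin.
Qed.

(** * Quadratic extensions in coordinates *)

Definition quad_definable (T : finType) (g : forall K : fieldType, (T -> K) -> K * K) : Prop :=
  term_definable (fun K h => (g K h).1) /\ term_definable (fun K h => (g K h).2).

Lemma term_definable_ext (T : finType) (g g' : forall K : fieldType, (T -> K) -> K) :
  (forall K h, g K h = g' K h) -> term_definable g -> term_definable g'.
Proof. by move=> gg' [t r e]; exists t => // K h e'; rewrite e gg'. Qed.

Lemma quad_definable_ext (T : finType) (g g' : forall K : fieldType, (T -> K) -> K * K) :
  (forall K h, g K h = g' K h) -> quad_definable g -> quad_definable g'.
Proof.
by move=> gg' [d1 d2]; split; [move: d1|move: d2]; apply: term_definable_ext => K h; rewrite gg'.
Qed.

Section QuadClosure.
Variables (T : finType) (nu : forall K : fieldType, (T -> K) -> K).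
Hypothesis nu_def : term_definable (@nu).

Lemma quad_definable_inj (g : forall K : fieldType, (T -> K) -> K) :
  term_definable g -> quad_definable (fun K h => quad_inj (@nu K h) (g K h)).
Proof. by move=> dg; split=> //; apply: (term_definable_nat T 0). Qed.

Lemma quad_definable_nat (k : nat) :
  quad_definable (fun K h => k%:R : quad (@nu K h)).
Proof.
split; [have := term_definable_nat T k|have := term_definable_nat T 0];
  apply: term_definable_ext => K h.
  by elim: k => // k IHk; rewrite [in RHS]mulrSr /= -IHk -mulrSr.
by elim: k => // k IHk; rewrite mulrSr /= -IHk addr0.
Qed.

Lemma quad_definable_add (g1 g2 : forall K : fieldType, (T -> K) -> K * K) :
  quad_definable g1 -> quad_definable g2 ->
  quad_definable (fun K h => (g1 K h : quad (@nu K h)) + (g2 K h : quad (@nu K h))).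
Proof. by move=> [a1 b1] [a2 b2]; split; apply: term_definable_add. Qed.

Lemma quad_definable_mul (g1 g2 : forall K : fieldType, (T -> K) -> K * K) :
  quad_definable g1 -> quad_definable g2 ->
  quad_definable (fun K h => (g1 K h : quad (@nu K h)) * (g2 K h : quad (@nu K h))).
Proof.
move=> [a1 b1] [a2 b2]; split.
  apply: term_definable_add; first exact: term_definable_mul.
  by apply/term_definable_opp/term_definable_mul/term_definable_mul.
apply: term_definable_add; first by apply: term_definable_add; apply: term_definable_mul.
by apply/term_definable_opp/term_definable_mul.
Qed.

Lemma quad_definable_sum (I : Type) (r : seq I) (E : I -> forall K : fieldType, (T -> K) -> K * K) :
  (forall i, quad_definable (E i)) ->
  quad_definable (fun K h => \sum_(i <- r) (E i K h : quad (@nu K h))).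
Proof.
move=> dE; elim: r => [|i r IHr].
  by apply: quad_definable_ext (quad_definable_nat 0) => K h; rewrite big_nil.
by apply: quad_definable_ext (quad_definable_add (dE i) IHr) => K h; rewrite big_cons.
Qed.

Lemma quad_definable_prod (I : Type) (r : seq I) (E : I -> forall K : fieldType, (T -> K) -> K * K) :
  (forall i, quad_definable (E i)) ->
  quad_definable (fun K h => \prod_(i <- r) (E i K h : quad (@nu K h))).
Proof.
move=> dE; elim: r => [|i r IHr].
  by apply: quad_definable_ext (quad_definable_nat 1) => K h; rewrite big_nil.
by apply: quad_definable_ext (quad_definable_mul (dE i) IHr) => K h; rewrite big_cons.
Qed.

Lemma quad_definable_exp (g : forall K : fieldType, (T -> K) -> K * K) (k : nat) :
  quad_definable g -> quad_definable (fun K h => (g K h : quad (@nu K h)) ^+ k).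
Proof.
move=> dg; elim: k => [|k IHk].
  by apply: quad_definable_ext (quad_definable_nat 1) => K h; rewrite expr0.
by apply: quad_definable_ext (quad_definable_mul dg IHk) => K h; rewrite exprS.
Qed.

Lemma form_definable_quad_eq (g1 g2 : forall K : fieldType, (T -> K) -> K * K) :
  quad_definable g1 -> quad_definable g2 -> form_definable (fun K h => g1 K h = g2 K h).
Proof.
move=> [a1 b1] [a2 b2].
apply: form_definable_ext (form_definable_and (form_definable_eq a1 a2) (form_definable_eq b1 b2)).
move=> K h /=; case: (g1 K h) (g2 K h) => [x1 y1] [x2 y2] /=.
by split=> [[-> ->]|[-> ->]].
Qed.

(** The value lives in the ring [quad nu] for arbitrary [nu]: rootlessness depends on the field and
    on the valuation, so a uniform term can rely on ring operations only. *)
Lemma quad_definable_hyper_sum (n : nat) (J : finType)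
    (p : 'I_n -> forall K : fieldType, (T -> K) -> K * K)
    (v : J -> forall K : fieldType, (T -> K) -> (K * K) * (K * K)) :
  (forall i, quad_definable (p i)) ->
  (forall l, quad_definable (fun K h => (v l K h).1) /\ quad_definable (fun K h => (v l K h).2)) ->
  quad_definable (fun K h => hyper_sum (R := quad (@nu K h)) (fun i => p i K h) (fun l => v l K h)).
Proof.
move=> dp dv; have dv1 l := (dv l).1; have dv2 l := (dv l).2.
rewrite /hyper_sum /weight.
apply: quad_definable_add; last exact: quad_definable_nat 1.
apply: quad_definable_add; last exact: quad_definable_prod.
apply: quad_definable_sum => k; apply: quad_definable_prod => l.
apply: quad_definable_mul; first exact: quad_definable_exp.
apply: quad_definable_add => //; apply: quad_definable_add => //.
exact: quad_definable_mul.
Qed.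
End QuadClosure.

Lemma quad_definable_inl (T U : finType) (g : forall K : fieldType, (T -> K) -> K * K) :
  quad_definable g -> @quad_definable (T + U)%type (fun K h => g K (h \o inl)).
Proof.
move=> [d1 d2]; split; first exact: (term_definable_inl U d1).
exact: (term_definable_inl U d2).
Qed.

Section ResidualClosure.
Variables (T : finType) (nu : forall K : fieldType, (T -> K) -> K).
Hypothesis nu_def : term_definable (@nu).

Lemma form_definable_quad_exists (P : forall (K : fieldType), (T -> K) -> K * K -> Prop) :
  @form_definable (T + bool)%type
    (fun K h => P K (h \o inl) (h (inr false), h (inr true))) ->
  form_definable (fun K h => exists z : K * K, P K h z).
Proof.
move=> /form_definable_exists; apply: form_definable_ext => K h.
split=> [[g Pg]|[[a b] Pz]]; first by exists (g false, g true).
by exists (fun i => if i then b else a).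
Qed.

Lemma form_definable_residual (g : forall K : fieldType, (T -> K) -> K * K) :
  quad_definable g -> form_definable (fun K h => residual (g K h : quad (@nu K h))).
Proof.
move=> dg; apply: form_definable_and.
  apply: form_definable_ext (form_definable_not
    (form_definable_quad_eq dg (quad_definable_nat (@nu) 0))) => K h.
  by split=> /eqP.
apply: form_definable_quad_exists.
have nu' := term_definable_inl bool nu_def.
have dg' := quad_definable_inl bool dg.
have dz : @quad_definable (T + bool)%type (fun K h => (h (inr false), h (inr true))).
  by split; apply: term_definable_var.
pose nuT (K : fieldType) (h : T + bool -> K) := @nu K (h \o inl).
have d2 := quad_definable_nat (@nuT) 2; have d1 := quad_definable_nat (@nuT) 1.
have d0 := quad_definable_nat (@nuT) 0.
have dz2 := quad_definable_exp nu' 2 dz.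
apply: form_definable_or; apply: form_definable_and.
- exact: form_definable_quad_eq d2 d0.
- have dm := quad_definable_mul nu' dg' (quad_definable_add (@nuT) dz2 dz).
  exact: form_definable_quad_eq dm d1.
- exact: form_definable_not (form_definable_quad_eq d2 d0).
- exact: form_definable_quad_eq dz2 dg'.
Qed.

Lemma form_definable_rootless : form_definable (fun K h => rootless (@nu K h)).
Proof.
pose P (K : fieldType) (h : T + unit -> K) := h (inr tt) * h (inr tt) + h (inr tt) + @nu K (h \o inl) = 0.
have dP : @form_definable (T + unit)%type P.
  apply: form_definable_eq; last exact: (term_definable_nat _ 0).
  have dz := term_definable_var (inr tt : (T + unit)%type).
  apply: term_definable_add; last exact: term_definable_inl nu_def.
  by apply: term_definable_add => //; apply: term_definable_mul.
apply: form_definable_ext (form_definable_forall (form_definable_not dP)) => K h.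
split=> [H z|H g]; first by have := H (fun=> z); rewrite /P /= -expr2 => /eqP.
by rewrite /P /= -expr2; apply/eqP.
Qed.
End ResidualClosure.

(** * The extension property as a first-order sentence *)

Definition coord (i : nat) (lt : (i < 4)%N) : 'I_4 := Ordinal lt.

Definition quad_point (R : Type) (nu : R) (c : 'I_4 -> R) : quad nu * quad nu :=
  ((c (@coord 0 isT), c (@coord 1 isT)), (c (@coord 2 isT), c (@coord 3 isT))).

(** All data are elements of [K], and distinctness of the families as sets is a finite condition on
    coordinates, so that [nu], [p] and [v] can be quantified over in a sentence. *)
Definition extension_statement (K : fieldType) (m s : nat) (I : {set 'I_m})
    (nu : K) (p : 'I_s.+1 -> K) (v : 'I_m -> 'I_s -> 'I_4 -> K) : Prop :=
  rootless nu -> (forall i j, p i = p j -> i = j) ->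
  (forall i l, (quad_point nu (v i l)).2 <> 0) ->
  (forall i j, i != j ->
     ~ ((forall l, exists l', forall k, v i l k = v j l' k) /\
        (forall l, exists l', forall k, v j l k = v i l' k))) ->
  exists c : 'I_4 -> K, [/\ (quad_point nu c).2 <> 0, forall i l, ~ (forall k, c k = v i l k) &
    forall i, residual (hyper_sum (fun j => quad_inj nu (p j))
      (cons_family (quad_point nu c) (fun l => quad_point nu (v i l)))) <-> i \in I].

Lemma quad_point_inj (R : Type) (nu : R) (c d : 'I_4 -> R) :
  quad_point nu c = quad_point nu d <-> forall k, c k = d k.
Proof.
split=> [[e0 e1 e2 e3] [[|[|[|[|//]]]] lt]|e]; last by rewrite /quad_point !e.
- by rewrite (bool_irrelevance lt isT).
- by rewrite (bool_irrelevance lt isT).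
- by rewrite (bool_irrelevance lt isT).
- by rewrite (bool_irrelevance lt isT).
Qed.

Lemma quad_point_surj (R : Type) (nu : R) (w : quad nu * quad nu) : exists c, quad_point nu c = w.
Proof.
case: w => [[a b] [a' b']]; exists (fun k => nth a [:: a; b; a'; b'] k) => //.
Qed.

Lemma extension_statement_finite (K : finFieldType) (m s : nat) (I : {set 'I_m})
    (nu : K) (p : 'I_s.+1 -> K) (v : 'I_m -> 'I_s -> 'I_4 -> K) :
  (size_threshold m s <= #|K|)%N -> extension_statement I nu p v.
Proof.
move=> leK irr p_inj v0 vdiff.
have [||| c [c0 cv cI]] := @extension_property_finite (quad_field irr) #|K| m s
  (fun j => quad_inj nu (p j)) (fun i l => quad_point nu (v i l)) I (quad_field_frobenius irr) leK.
- by move=> i j [/p_inj].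
- by move=> i l; apply/eqP/v0.
- move=> i j ne [ij ji]; apply: (vdiff i j ne).
  by split=> l; [have [l' /quad_point_inj E] := ij l|have [l' /quad_point_inj E] := ji l]; exists l'.
have [d Dd] := @quad_point_surj K nu c; exists d; split.
- by rewrite Dd; move/eqP: c0.
- by move=> i l /(quad_point_inj nu) E; apply: (cv i l); rewrite -Dd E.
- by rewrite Dd.
Qed.

Lemma form_definable_and3 (T : finType) (P Q R : forall K : fieldType, (T -> K) -> Prop) :
  form_definable P -> form_definable Q -> form_definable R ->
  form_definable (fun K h => [/\ P K h, Q K h & R K h]).
Proof.
move=> dP dQ dR.
apply: form_definable_ext (form_definable_and dP (form_definable_and dQ dR)) => K h.
by split=> [[? [? ?]]|[? ? ?]].
Qed.

Section Transfer.
Variables (m s N : nat) (I : {set 'I_m}).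
Let T := (void + (unit + 'I_s.+1 + 'I_N + 'I_m * 'I_s * 'I_4))%type.
Let nuT (K : fieldType) (h : T -> K) := h (inr (inl (inl (inl tt)))).
Let pT (K : fieldType) (h : T -> K) j := h (inr (inl (inl (inr j)))).
Let dT (K : fieldType) (h : T -> K) j := h (inr (inl (inr j))).
Let vT (K : fieldType) (h : T -> K) i l k := h (inr (inr (i, l, k))).

(** Distinct values [dT] witness that the field has at least [N] elements; smaller finite fields
    satisfy the implication vacuously. [T] begins with [void] so that quantifying over the rest
    leaves a sentence. *)
Lemma form_definable_extension : @form_definable T (fun K h =>
  (forall i j, dT h i = dT h j -> i = j) -> extension_statement I (nuT h) (pT h) (vT h)).
Proof.
have var U t := @term_definable_var U t.
rewrite /extension_statement.
apply: form_definable_imp.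
  apply: form_definable_finall => i; apply: form_definable_finall => j.
  by apply: form_definable_imp (form_definable_const _ _); apply: form_definable_eq; apply: var.
apply: form_definable_imp; first exact: form_definable_rootless (var _ _).
apply: form_definable_imp.
  apply: form_definable_finall => i; apply: form_definable_finall => j.
  by apply: form_definable_imp (form_definable_const _ _); apply: form_definable_eq; apply: var.
apply: form_definable_imp.
  apply: form_definable_finall => i; apply: form_definable_finall => l.
  apply: form_definable_not; apply: form_definable_quad_eq; last exact: (quad_definable_nat (@nuT) 0).
  by split; apply: var.
apply: form_definable_imp.
  apply: form_definable_finall => i; apply: form_definable_finall => j.
  apply: form_definable_imp; first exact: form_definable_const.
  apply: form_definable_not; apply: form_definable_and;
  apply: form_definable_finall => l; apply: form_definable_finex => l';
  apply: form_definable_finall => k; apply: form_definable_eq; apply: var.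
pose T' := (T + 'I_4)%type.
pose nuT' (K : fieldType) (h : T' -> K) := nuT (h \o inl).
suff dP : @form_definable T' (fun K h => [/\ (quad_point (nuT' K h) (h \o inr)).2 <> 0,
    forall i l, ~ (forall k, (h \o inr) k = vT (h \o inl) i l k) &
    forall i, residual (hyper_sum (fun j => quad_inj (nuT' K h) (pT (h \o inl) j))
      (cons_family (quad_point (nuT' K h) (h \o inr))
         (fun l => quad_point (nuT' K h) (vT (h \o inl) i l)))) <-> i \in I]).
  exact: form_definable_exists dP.
have nu' : term_definable nuT' by apply: (var T' (inl (inr (inl (inl (inl tt)))))).
apply: form_definable_and3.
- apply: form_definable_not; apply: form_definable_quad_eq; last exact: (quad_definable_nat (@nuT') 0).
  split; [exact: (var T' (inr _))|exact: (var T' (inr _))].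
- apply: form_definable_finall => i; apply: form_definable_finall => l.
  apply: form_definable_not; apply: form_definable_finall => k.
  by apply: form_definable_eq; apply: var.
apply: form_definable_finall => i.
apply: form_definable_iff; last exact: form_definable_const.
apply: (form_definable_residual nu').
apply: (quad_definable_hyper_sum nu') => [j|l].
  exact: (quad_definable_inj nuT' (var _ _)).
rewrite /cons_family; case: (unlift ord0 l) => [l'|].
  by split; split; apply: var.
by split; split; [exact: (var T' (inr _))..].
Qed.
End Transfer.

(** * The random hypergraph *)

From mathcomp Require Import classical_sets functions cardinality.

Lemma infinite_inj_ord (T : choiceType) (N : nat) :
  infinite_set [set: T]%classic -> exists d : 'I_N -> T, injective d.
Proof.
move=> infT.
have [s us ss] : exists2 s : seq T, uniq s & size s = N.
  elim: N => [|N [s us ss]]; first by exists [::].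
  have [x xs] : exists x, x \notin s.
    apply: contrapT => /forallNP ins; apply: infT; apply/finite_seqP; exists s.
    by apply/seteqP; split=> x //= _; have /negP := ins x; rewrite negbK.
  by exists (x :: s); rewrite /= ?xs ?ss.
by rewrite -ss; exists (tnth (in_tuple s)); apply/tuple_uniqP.
Qed.

Lemma extension_statement_pseudofinite (F : fieldType) (m s : nat) (I : {set 'I_m})
    (nu : F) (p : 'I_s.+1 -> F) (v : 'I_m -> 'I_s -> 'I_4 -> F) :
  pseudofinite F -> extension_statement I nu p v.
Proof.
move=> pF; have [infF _] := pF.
have := pseudofinite_transfer pF
  (form_definable_forall (form_definable_extension s (size_threshold m s) I)).
have [d d_inj] := infinite_inj_ord (size_threshold m s) infF.
move=> /(_ _ (of_void F)
  (fun u => match u with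
    | inl (inl (inl _)) => nu | inl (inl (inr j)) => p j | inl (inr i) => d i
    | inr (i, l, k) => v i l k end)) /=; apply=> //.
move=> K h g; rewrite /= => dK; apply: extension_statement_finite.
by rewrite -[X in (X <= _)%N]card_ord; apply: leq_card dK.
Qed.

Lemma exists_rootless_pseudofinite (F : fieldType) :
  pseudofinite F -> exists nu : F, rootless nu.
Proof.
move=> pF; have dR := form_definable_rootless (term_definable_var (inr tt : (void + unit)%type)).
have [K h|g Hg] := pseudofinite_transfer pF (form_definable_exists dR) _ (of_void F).
  by have [nu irr] := exists_rootless K; exists (fun=> nu).
by exists (g tt).
Qed.

Lemma prod_injective_range (R : comNzRingType) (T : eqType) (J : finType) (u w : J -> T) (g : T -> R) :
  injective u -> injective w -> (forall x, (exists i, u i = x) <-> (exists i, w i = x)) ->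
  \prod_i g (u i) = \prod_i g (w i).
Proof.
move=> u_inj w_inj same.
have codomE (z : J -> T) : \prod_i g (z i) = \prod_(x <- codom z) g x.
  by rewrite big_map big_enum.
rewrite !codomE; apply: perm_big; apply: uniq_perm; try by rewrite map_inj_uniq ?enum_uniq.
move=> x; apply/codomP/codomP => -[i Dx].
  by have [j <-] := (same x).1 (ex_intro _ i (esym Dx)); exists j.
by have [j <-] := (same x).2 (ex_intro _ i (esym Dx)); exists j.
Qed.

Lemma nsubsets_enum (T : Type) (s : nat) (A : set T) :
  nsubsets s A -> exists u : 'I_s -> T, injective u /\ A = range u.
Proof.
move=> cardA; have /card_bijP[f [g fK gK]] : ([set: 'I_s] #= A)%card.
  by apply: card_eq_trans (card_esym card_II) _; apply: card_esym.
exists (fun i => val (f (to_setT i))); split.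
  by move=> i j /val_inj /(can_inj fK) /(congr1 val).
apply/seteqP; split=> [x xA|_ [i _ <-]]; last exact: set_valP.
exists (val (g (SigSub (mem_set xA)))) => //.
have -> : to_setT (val (g (SigSub (mem_set xA)))) = g (SigSub (mem_set xA)) by apply: val_inj.
by rewrite gK.
Qed.

Lemma range_nsubsets (T : Type) (s : nat) (u : 'I_s -> T) : injective u -> nsubsets s (range u).
Proof.
move=> u_inj; apply: card_eq_trans (card_esym card_II).
by apply: inj_card_eq; apply: in2W.
Qed.

Definition tuple_coords (F : Type) (m k : nat) (x : m.-tuple (k.-tuple F)) (ij : 'I_m * 'I_k) : F :=
  tnth (tnth x ij.1) ij.2.

(** Product types are enumerated lexicographically, in agreement with the numbering [i * k + j] of
    [definable]. *)
Lemma env_tuple_coords (F : Type) (m k : nat) (x : m.-tuple (k.-tuple F)) :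
  env (tuple_coords x) = flatten [seq tval u | u <- x].
Proof.
rewrite /env enumT [in LHS]unlock /= /prod_enum map_allpairs; congr flatten.
transitivity [seq tval (tnth x i) | i <- enum 'I_m].
  by apply: eq_map => i; rewrite -[RHS]map_tnth_enum.
by rewrite (map_comp (@tval k F) (tnth x)) map_tnth_enum.
Qed.

Lemma definable_of_form (F : fieldType) (m k : nat) (U : finType)
    (P : forall K : fieldType, ('I_m * 'I_k + U -> K) -> Prop) (g : U -> F)
    (S : set (m.-tuple (k.-tuple F))) :
  @form_definable ('I_m * 'I_k + U)%type P ->
  (forall x, S x <-> P F (sum_fun (tuple_coords x) g)) -> definable S.
Proof.
move=> dP SP; have [f rf fE] := definable_with_parameters g dP.
by exists f; split=> // x; rewrite SP -fE env_tuple_coords.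
Qed.

Section Hypergraph.
Variables (F : fieldType) (s : nat) (nu : F) (p : 'I_s.+1 -> F).
Hypotheses (pF : pseudofinite F) (irr : rootless nu) (p_inj : injective p).
Let n := s.+1.

Definition vertex_point (x : 4.-tuple F) : quad nu * quad nu := quad_point nu (tnth x).

Definition hvertex : Type := {x : 4.-tuple F | (vertex_point x).2 != 0}.
HB.instance Definition _ := Choice.on hvertex.
HB.instance Definition _ := SubType.on hvertex.

Let value (J : finType) (u : J -> hvertex) : quad nu :=
  hyper_sum (fun j => quad_inj nu (p j)) (fun i => vertex_point (val (u i))).

Definition hedge : set (set hvertex) :=
  [set A | exists u : 'I_n -> hvertex, [/\ injective u, A = range u & residual (value u)]]%classic.

Lemma hedge_card : (hedge `<=` nsubsets n)%classic.
Proof. by move=> _ [u [u_inj -> _]]; apply: range_nsubsets. Qed.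

Definition residual_hypergraph : hypergraph n := Hypergraph hedge_card.

(** [hyper_sum] is symmetric, so the enumeration hidden in [hedge] may be replaced by [u], which is
    injective because its range has [n] elements. *)
Lemma hedge_range (u : 'I_n -> hvertex) :
  hedge (range u) <-> injective u /\ residual (value u).
Proof.
split=> [[w [w_inj uw resw]]|[u_inj resu]]; last by exists u.
have same x : (exists i, u i = x) <-> (exists i, w i = x).
  split=> -[i Dx]; have : range u x \/ range w x by [left; exists i|right; exists i].
    by rewrite uw => -[|] [j _ <-]; exists j.
  by rewrite -uw => -[|] [j _ <-]; exists j.
have u_inj : injective u.
  have uniqw : uniq (codom w) by rewrite map_inj_uniq ?enum_uniq.
  have : uniq (codom u).
    apply: leq_size_uniq uniqw _ _; last by rewrite !size_codom.
    move=> _ /codomP[i ->]; have [_ /(_ (ex_intro _ i erefl))[j <-]] := same (w i).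
    exact: codom_f.
  by move/injectiveP.
split=> //; suff -> : value u = value w by [].
rewrite /value /hyper_sum; congr (_ + _ + _).
  apply: eq_bigr => k _.
  exact: (prod_injective_range (fun y => weight _ k (vertex_point (val y))) u_inj w_inj same).
exact: (prod_injective_range (fun y => (vertex_point (val y)).2) u_inj w_inj same).
Qed.

Lemma infinite_hvertex : infinite_set [set: hvertex]%classic.
Proof.
have [infF _] := pF; apply: contra_not infF => finV.
have -> : [set: F]%classic = ((fun x : hvertex => tnth (val x) ord0) @` [set: hvertex])%classic.
  apply/seteqP; split=> // a _.
  have h1 : (vertex_point [tuple a; 0; 1; 0]).2 != 0.
    by apply/eqP => -[/eqP]; rewrite (tnth_nth 0) /= oner_eq0.
  by exists (exist (fun x => is_true ((vertex_point x).2 != 0)) _ h1) => //=; rewrite (tnth_nth 0).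
exact: finite_image.
Qed.

Lemma residual_hypergraph_random : random_hypergraph residual_hypergraph.
Proof.
move=> m a a_inj a_card I.
have /fin_all_exists[u uP] : forall i, exists u : 'I_s -> hvertex, injective u /\ a i = range u.
  by move=> i; apply: nsubsets_enum; apply: a_card.
have [|i l|i j ne [ij ji]|c [c0 cu cI]] := @extension_statement_pseudofinite F m s I nu p
  (fun i l => tnth (val (u i l))) pF irr.
- exact: p_inj.
- exact/eqP/(valP (u i l)).
- have eq_u x y : (forall k, tnth (val x) k = tnth (val y) k) -> x = y :> hvertex.
    by move=> e; apply/val_inj/eq_from_tnth.
  move/eqP: ne; apply; apply: a_inj; rewrite (uP i).2 (uP j).2.
  apply/seteqP; split=> _ [l _ <-].
    by have [l' /eq_u ->] := ij l; exists l'.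
  by have [l' /eq_u ->] := ji l; exists l'.
pose x : 4.-tuple F := mktuple c.
have xE : vertex_point x = quad_point nu c by apply/quad_point_inj => k; rewrite tnth_mktuple.
have x0 : (vertex_point x).2 != 0 by rewrite xE; apply/eqP.
pose X : hvertex := exist (fun x => is_true ((vertex_point x).2 != 0)) x x0.
exists X => i; rewrite -cI.
have [ui_inj ->] := uP i.
have -> : (range (u i) `|` [set X] = range (cons_family X (u i)))%classic.
  apply/seteqP; split=> [y [[l _ <-]| ->]|_ [l _ <-]].
  - by exists (lift ord0 l) => //; rewrite /cons_family liftK.
  - by exists ord0 => //; rewrite /cons_family unlift_none.
  - by rewrite /cons_family; case: (unlift ord0 l) => [l'|]; [left; exists l'|right].
have valE : value (cons_family X (u i)) = hyper_sum (fun j => quad_inj nu (p j))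
    (cons_family (quad_point nu c) (fun l => quad_point nu (tnth (val (u i l))))).
  by rewrite /value -xE; congr hyper_sum; apply/funext => l; rewrite /cons_family; case: unlift.
rewrite /= hedge_range valE; split=> [[]//|res]; split=> // l l'.
(* An edge needs an injective enumeration, hence a new vertex outside [a i]. *)
have Xu j : X <> u i j.
  by move=> e; apply: (cu i j) => k; rewrite -e tnth_mktuple.
rewrite /cons_family; case: unliftP => [j ->|->]; case: unliftP => [j' ->|->] //.
- by move/ui_inj ->.
- by move/esym/Xu.
- by move/Xu.
Qed.

Lemma residual_hypergraph_interpretable : interpretable F residual_hypergraph.
Proof.
(* The vertex [t = 0], [x = 1], which [insubd] returns outside [D]. *)
have v0 : hvertex.
  exists [tuple 0; 0; 1; 0].
  by apply/eqP => -[/eqP]; rewrite (tnth_nth 0) /= oner_eq0.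
pose D : set (4.-tuple F) := [set x | (vertex_point x).2 <> 0]%classic.
have piK x : D x -> val (insubd v0 x : hvertex) = x by move/eqP => Dx; rewrite val_insubd Dx.
pose U := (unit + 'I_n)%type.
pose g (i : U) := match i with inl _ => nu | inr j => p j end.
pose nuT m (K : fieldType) (h : 'I_m * 'I_4 + U -> K) := h (inr (inl tt)).
pose xT m (K : fieldType) (h : 'I_m * 'I_4 + U -> K) i k := h (inl (i, k)).
have dD m i : @form_definable ('I_m * 'I_4 + U)%type
    (fun K h => (quad_point (nuT m K h) (xT m K h i)).2 <> 0).
  apply: form_definable_not; apply: form_definable_quad_eq; last exact: (quad_definable_nat (nuT m) 0).
  by split; apply: term_definable_var.
have eqD m (i j : 'I_m) : @form_definable ('I_m * 'I_4 + U)%type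
    (fun K h => forall k, xT m K h i k = xT m K h j k).
  by apply: form_definable_finall => k; apply: form_definable_eq; apply: term_definable_var.
exists 4, D, (insubd v0); split.
- move=> x _; exists (val x); last by rewrite valKd.
  exact/eqP/(valP x).
- by apply: (definable_of_form (g := g) (dD 1 ord0)) => x.
- apply: (definable_of_form (g := g)
    (form_definable_and3 (dD 2 ord0) (dD 2 ord_max) (eqD 2 ord0 ord_max))) => x.
  split=> [[D0 D1 e]|[D0 D1 e]]; split=> //.
    by move=> k; rewrite /xT /= /tuple_coords /= -(piK _ D0) e piK.
  by congr insubd; apply/eq_from_tnth => k; apply: e.
(* The range of a tuple is an edge only if its [n] entries are distinct; the second clause says so
   in coordinates. *)
pose P (K : fieldType) (h : 'I_n * 'I_4 + U -> K) :=
  [/\ forall i, (quad_point (nuT n K h) (xT n K h i)).2 <> 0,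
    forall i j, (forall k, xT n K h i k = xT n K h j k) -> i = j &
    residual (hyper_sum (fun j => quad_inj (nuT n K h) (h (inr (inr j))))
      (fun i => quad_point (nuT n K h) (xT n K h i)))].
have dP : @form_definable ('I_n * 'I_4 + U)%type P.
  apply: form_definable_and3.
  - by apply: form_definable_finall => i; apply: dD.
  - apply: form_definable_finall => i; apply: form_definable_finall => j.
    exact: form_definable_imp (eqD n i j) (form_definable_const _ _).
  have nu' : term_definable (nuT n) by apply: term_definable_var.
  apply: (form_definable_residual nu').
  apply: (quad_definable_hyper_sum nu') => [j|l].
    exact: (quad_definable_inj (nuT n) (term_definable_var _)).
  by split; split; apply: term_definable_var.
apply: (definable_of_form (g := g) dP) => x; rewrite /P /=.
pose u i : hvertex := insubd v0 (tnth x i).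
have valueE : (forall i, D (tnth x i)) -> value u =
    hyper_sum (fun j => quad_inj nu (p j)) (fun i => quad_point nu (fun k => tnth (tnth x i) k)).
  by move=> Dx; rewrite /value; congr hyper_sum; apply/funext => i; rewrite /u piK.
split=> [[Dx /hedge_range[u_inj res]]|[Dx x_inj res]].
  split=> //; last by rewrite -[hyper_sum _ _]valueE.
  move=> i j e; apply: u_inj; congr insubd; exact: eq_from_tnth.
split=> //; apply/hedge_range; split; last by rewrite -[value _]/(value u) valueE.
move=> i j e; apply: x_inj => k; rewrite /xT /= /tuple_coords /=.
suff -> : tnth x i = tnth x j by [].
by rewrite -(piK _ (Dx i)) -(piK _ (Dx j)); apply: congr1 e.
Qed.
End Hypergraph.

Theorem mainTheorem1 (F : fieldType) (hF : pseudofinite F)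
    (n : nat) (hn : (2 <= n)%N) :
  exists H : hypergraph n,
    [/\ infinite_set [set: H]%classic, random_hypergraph H & interpretable F H].
Proof.
case: n hn => // s _; have [nu irr] := exists_rootless_pseudofinite hF.
have [p p_inj] := infinite_inj_ord s.+1 hF.1.
exists (residual_hypergraph nu p); split.
- exact: infinite_hvertex.
- exact: residual_hypergraph_random.
- exact: residual_hypergraph_interpretable.
Qed.
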